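(* Let $T>0$, $d\geq1$. Assume that there exists $\alpha\in(0,1)$ with $b\in L^{\infty}(0,T;C_b^{\alpha}(\mathbb{R}^d;\mathbb{R}^d))$, that $\mathrm{div}\,b\in L^1(0,T;L^1_{\mathrm{loc}}(\mathbb{R}^d))$, and that $u_0\in C_b^0(\mathbb{R}^d)$ (bounded continuous). Let $(W_n)_{n\ge1}$ be a sequence of $\mathbb{R}^d$-valued processes with regular (differentiable in time) paths, defined on the same probability space as the $d$-dimensional Brownian motion $W$, converging in probability to $W$ in the topology of $C^0([0,T];\mathbb{R}^d)$. Let $\{b_n\}_{n\ge1}$ be a sequence of measurable fields $[0,T]\times\mathbb{R}^d\to\mathbb{R}^d$, equibounded in $(t,x,n)$, such that for a.e. $t\in[0,T]$ we have $b_n(t,\cdot)\in C_b^1(\mathbb{R}^d)$ and $b_n(t,\cdot)\to b(t,\cdot)$ uniformly on compact sets. Let $u_n(t,x)$ be the unique $L^{\infty}$ solution of the equation $$\frac{\partial u_n(t,x)}{\partial t}+b_n(t,x)\cdot Du_n(t,x)+\sum_{i=1}^dD_iu_n(t,x)\frac{dW^i_n(t)}{dt}=0,\qquad u_n(0,x)=u_0(x),$$ and let $u(t,x)=u_0(\phi_t^{-1}(x))$ be the solution of $$d_tu(t,x)+(b(t,x)\cdot Du(t,x))\,dt+\sum_{i=1}^d e_i\cdot Du(t,x)\circ dW^i_t=0,\qquad u(0,x)=u_0(x),$$ where $\phi_t=\phi_{0,t}$ is the stochastic flow of diffeomorphisms associated to $dX_t=b(t,X_t)dt+dW_t$. Then,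 for every $t\in[0,T]$ and $x\in\mathbb{R}^d$, $u_n(t,x)$ converges in probability to $u(t,x)$.
   Context: A stochastic basis $(\Omega,(\mathcal{F}_t),\mathcal{F},P)$ with a standard $d$-dimensional Brownian motion $W$ is given; $(e_i)$ is the canonical basis of $\mathbb{R}^d$; $\circ\,dW$ denotes Stratonovich integration; $\mathrm{div}$ is the distributional divergence in $x$. $L^{\infty}(0,T;C_b^{\alpha}(\mathbb{R}^d;\mathbb{R}^d))$ is the space of bounded Borel vector fields $f:[0,T]\times\mathbb{R}^d\to\mathbb{R}^d$ with $\sup_{t\in[0,T]}\sup_{x\neq y}|f(t,x)-f(t,y)|/|x-y|^{\alpha}<\infty$. For such $b$ there is a stochastic flow of diffeomorphisms $\phi_{s,t}$ ($0\le s\le t\le T$) associated to $dX_t=b(t,X_t)dt+dW_t$: for each $(s,x)$, $t\mapsto\phi_{s,t}(x)$ is the unique continuous adapted solution on $[s,T]$ with value $x$ at time $s$; $P$-a.s. all $\phi_{s,t}$ are $C^1$-diffeomorphisms of $\mathbb{R}^d$ with $\phi_{s,t},\phi_{s,t}^{-1},D\phi_{s,t},D\phi_{s,t}^{-1}$ continuous in $(s,t,x)$; and $P$-a.s. $\phi_{s,t}=\phi_{u,t}\circ\phi_{s,u}$ for all $s\le u\le t$, $\phi_{s,s}=\mathrm{id}$. The approximating equation is a transport equation understood $\omega$ by $\omega$; its unique $L^\infty$ solution (existence and uniqueness being part of the setting) is evaluated pointwise through its representation $u_n(t,x)=u_0(\varphi_{n,t}^{-1}(x))$, where $\varphi_{n,t}$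 is the flow (from time $0$ to time $t$) of $\frac{dX_n(t)}{dt}=b_n(t,X_n(t))+\frac{dW_n(t)}{dt}$. *)

(* Defs.v *)
From HB Require Import structures.
From mathcomp Require Import all_boot all_order all_algebra.
From mathcomp Require Import all_classical all_reals all_analysis.
Import Order.TTheory GRing.Theory Num.Theory.
Import numFieldNormedType.Exports.

Set Implicit Arguments.
Unset Strict Implicit.
Unset Printing Implicit Defensive.

Local Open Scope classical_set_scope.
Local Open Scope ring_scope.

(* R^n is 'rV[R]_n. Its norm in the library is the sup norm; every condition
   below is insensitive to replacing it by the Euclidean one. *)

Section rV_measurable.
Context {R : realType} (n : nat).

(* The Borel sigma-algebra of R^n, generated by the coordinates. *)
Definition rV_cylinder : set (set 'rV[R]_n) :=
  [set A | exists i : 'I_n, exists2 B : set R, measurable B &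
     A = [set v : 'rV[R]_n | B (v ord0 i)]].

Let rV_set0 : <<s rV_cylinder >> set0.
Proof. exact: sigma_algebra0. Qed.

Let rV_setC A : <<s rV_cylinder >> A -> <<s rV_cylinder >> (~` A).
Proof. exact: sigma_algebraC. Qed.

Let rV_bigcup (F : _^nat) : (forall i, <<s rV_cylinder >> (F i)) ->
  <<s rV_cylinder >> (\bigcup_i (F i)).
Proof. exact: sigma_algebra_bigcup. Qed.

HB.instance Definition _ := @isMeasurable.Build default_measure_display
  'rV[R]_n <<s rV_cylinder >> rV_set0 rV_setC rV_bigcup.

End rV_measurable.

Section rV_cons.
Context {R : realType} (n : nat).

Definition rV_cons (p : R * 'rV[R]_n) : 'rV[R]_n.+1 := row_mx p.1%:M p.2.

Lemma rV_cons0 (p : R * 'rV[R]_n) : rV_cons p ord0 ord0 = p.1.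
Proof.
have -> : ord0 = lshift n ord0 :> 'I_(1 + n) by apply: val_inj.
by rewrite /rV_cons; apply: (etrans (row_mxEl _ _ _ _)); rewrite mxE eqxx mulr1n.
Qed.

Lemma rV_consS (p : R * 'rV[R]_n) j : rV_cons p ord0 (lift ord0 j) = p.2 ord0 j.
Proof.
have -> : lift ord0 j = rshift 1 j by apply: val_inj.
exact: row_mxEr.
Qed.

Lemma measurable_rV_cons : measurable_fun setT rV_cons.
Proof.
apply: (@measurability _ _ _ _ _ _ (@rV_cylinder R n.+1)) => //.
move=> _ [_ [i [B mB ->]] <-]; rewrite setTI.
case: (unliftP ord0 i) => [j|] ->.
  rewrite (_ : _ @^-1` _ = snd @^-1` [set v : 'rV[R]_n | B (v ord0 j)]).
    rewrite -[X in measurable X]setTI.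
    apply: (@measurable_snd _ _ R 'rV[R]_n) => //.
    by apply: sub_sigma_algebra; exists j, B.
  by apply/seteqP; split => p /=; rewrite rV_consS.
rewrite (_ : _ @^-1` _ = fst @^-1` B).
  rewrite -[X in measurable X]setTI.
  exact: (@measurable_fst _ _ R 'rV[R]_n).
by apply/seteqP; split => p /=; rewrite rV_cons0.
Qed.

Definition rV_uncons (v : 'rV[R]_n.+1) : R * 'rV[R]_n :=
  (v ord0 ord0, \row_j v ord0 (lift ord0 j)).

Lemma measurable_rV_uncons : measurable_fun setT rV_uncons.
Proof.
apply: measurable_fun_pair.
  move=> _ B mB; rewrite setTI; apply: sub_sigma_algebra.
  by exists ord0, B.
apply: (@measurability _ _ _ _ _ _ (@rV_cylinder R n)) => //.
move=> _ [_ [i [B mB ->]] <-]; rewrite setTI; apply: sub_sigma_algebra.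
by exists (lift ord0 i), B => //; apply/seteqP; split => v /=; rewrite mxE.
Qed.

Lemma rV_consK : cancel rV_cons rV_uncons.
Proof.
move=> p; rewrite /rV_uncons rV_cons0; case: p => x v; congr pair.
by apply/rowP => j; rewrite mxE rV_consS.
Qed.

End rV_cons.
Arguments rV_cons {R n} p.
Arguments rV_uncons {R n} v.

Section rV_lebesgue.
Context {R : realType}.

Section step.
Context (n : nat) (mu : {sigma_finite_measure set 'rV[R]_n -> \bar R}).

Definition lebesgue_step : set 'rV[R]_n.+1 -> \bar R :=
  pushforward (lebesgue_measure \x mu)%E rV_cons.

Let lebesgue_step0 : lebesgue_step set0 = 0%E.
Proof. by rewrite /lebesgue_step /pushforward preimage_set0 measure0. Qed.

Let lebesgue_step_ge0 A : (0 <= lebesgue_step A)%E.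
Proof. by rewrite /lebesgue_step /pushforward; exact: integral_ge0. Qed.

Let lebesgue_step_sigma_additive : semi_sigma_additive lebesgue_step.
Proof.
have mcons A : measurable A -> measurable (rV_cons @^-1` A : set (R * 'rV[R]_n)).
  by move=> mA; rewrite -[X in measurable X]setTI; exact: measurable_rV_cons.
move=> F mF tF mUF; rewrite /lebesgue_step /pushforward preimage_bigcup.
apply: measure_semi_sigma_additive.
- by move=> k; exact: mcons.
- apply/trivIsetP => /= i j _ _ ij; rewrite -preimage_setI.
  by move/trivIsetP : tF => /(_ i j I I ij) ->; rewrite preimage_set0.
- by rewrite -preimage_bigcup; exact: mcons.
Qed.

HB.instance Definition _ := isMeasure.Build _ _ _ lebesgue_step
  lebesgue_step0 lebesgue_step_ge0 lebesgue_step_sigma_additive.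

Let lebesgue_step_sigma_finite : sigma_finite setT lebesgue_step.
Proof.
have /sigma_finiteP[F [TF ndF Foo]] := @sigma_finiteT _ _ _ (@lebesgue_measure R).
have /sigma_finiteP[G [TG ndG Goo]] := sigma_finiteT mu.
have consK (A : set (R * 'rV[R]_n)) : rV_cons @^-1` (rV_uncons @^-1` A) = A.
  by apply/seteqP; split => p /=; rewrite rV_consK.
exists (fun k => rV_uncons @^-1` (F k `*` G k)).
  rewrite -preimage_bigcup; apply/seteqP; split => // v _ /=.
  have [i _ Fi] : (\bigcup_i F i) (rV_uncons v).1 by rewrite -TF.
  have [j _ Gj] : (\bigcup_i G i) (rV_uncons v).2 by rewrite -TG.
  exists (maxn i j) => //; split.
    by move: Fi; exact/subsetPset/ndF/leq_maxl.
  by move: Gj; exact/subsetPset/ndG/leq_maxr.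
move=> k; have [mF Fk] := Foo k; have [mG Gk] := Goo k; split.
  by rewrite -[X in measurable X]setTI; apply: measurable_rV_uncons => //;
    exact: measurableX.
rewrite /lebesgue_step /pushforward consK product_measure1E//.
by rewrite lte_mul_pinfty// ge0_fin_numE.
Qed.

HB.instance Definition _ := Measure_isSigmaFinite.Build _ _ _ lebesgue_step
  lebesgue_step_sigma_finite.

End step.

(* Lebesgue measure on R^n, the n-fold product of that of R. *)
Fixpoint lebesgue_rV (n : nat) : {sigma_finite_measure set 'rV[R]_n -> \bar R} :=
  match n with
  | 0 => \d_(0 : 'rV[R]_0)
  | m.+1 => lebesgue_step (lebesgue_rV m)
  end.

End rV_lebesgue.

Section analysis_on_Rn.
Context {R : realType} (n : nat).
Local Notation leb := (@lebesgue_measure R).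
Local Notation lebn := (@lebesgue_rV R n).
Local Notation lebTx := (leb \x lebn)%E.

Definition inverse (f : 'rV[R]_n -> 'rV[R]_n) (y : 'rV[R]_n) : 'rV[R]_n :=
  xget 0 (f @^-1` [set y]).

Definition homeomorphism (f : 'rV[R]_n -> 'rV[R]_n) :=
  [/\ bijective f, continuous f & continuous (inverse f)].

Definition C1 (f : 'rV[R]_n -> 'rV[R]_n) :=
  (forall x, differentiable f x) /\ continuous (jacobian f).

Definition C1_diffeomorphism (f : 'rV[R]_n -> 'rV[R]_n) :=
  [/\ bijective f, C1 f & C1 (inverse f)].

Definition C1b (f : 'rV[R]_n -> 'rV[R]_n) :=
  C1 f /\ exists M, forall x, `|f x| <= M /\ `|jacobian f x| <= M.

Definition partial (i : 'I_n) (f : 'rV[R]_n -> R) : 'rV[R]_n -> R :=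
  'D_(delta_mx ord0 i) f.

(* C_c^oo(R^n): all iterated partial derivatives exist and are differentiable. *)
Definition test_function (theta : 'rV[R]_n -> R) :=
  (forall (s : seq 'I_n) x, differentiable (foldr partial theta s) x) /\
  (exists r, forall x, r < `|x| -> theta x = 0).

(* Vector fields and functions on [0,T] x R^n are total functions of (t, x);
   only their values on this strip matter. *)
Definition strip (T : R) : set (R * 'rV[R]_n) := `[0, T] `*` setT.

Definition Linfty_Cb (T alpha : R) (b : R -> 'rV[R]_n -> 'rV[R]_n) :=
  [/\ measurable_fun (strip T) (fun p : R * 'rV[R]_n => b p.1 p.2),
      exists M, forall t x, t \in `[0, T] -> `|b t x| <= M &
      exists K, forall t x y, t \in `[0, T] ->
        `|b t x - b t y| <= K * `|x - y| `^ alpha].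

(* D is the distributional divergence in x of b. *)
Definition is_divergence (T : R) (b : R -> 'rV[R]_n -> 'rV[R]_n)
    (D : R -> 'rV[R]_n -> R) :=
  measurable_fun (strip T) (fun p : R * 'rV[R]_n => D p.1 p.2) /\
  {ae leb, forall t, t \in `[0, T] -> forall theta, test_function theta ->
    lebn.-integrable setT (fun x => (D t x * theta x)%:E) /\
    \int[lebn]_x (\sum_(i < n) b t x ord0 i * partial i theta x) =
      - \int[lebn]_x (D t x * theta x)}.

Definition L1_L1loc (T : R) (D : R -> 'rV[R]_n -> R) :=
  forall r, lebTx.-integrable (`[0, T] `*` [set x | `|x| <= r])
    (fun p => (D p.1 p.2)%:E).

Definition essentially_bounded (T : R) (v : R -> 'rV[R]_n -> R) :=
  measurable_fun (strip T) (fun p : R * 'rV[R]_n => v p.1 p.2) /\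
  exists M, {ae lebTx, forall p, strip T p -> `|v p.1 p.2| <= M}.

(* v (B . D theta + (div B) theta), the integrand of the weak form of
   - B . Dv tested against theta. *)
Definition transport_integrand (B : R -> 'rV[R]_n -> 'rV[R]_n)
    (divB v : R -> 'rV[R]_n -> R) (theta : 'rV[R]_n -> R)
    (p : R * 'rV[R]_n) : R :=
  v p.1 p.2 * (\sum_(i < n) B p.1 p.2 ord0 i * partial i theta p.2
               + divB p.1 p.2 * theta p.2).

(* v is an L^oo weak solution of dv/dt + (b + dw/dt) . Dv = 0, v(0) = v0;
   since dw/dt does not depend on x, div (b + dw/dt) = div b. *)
Definition transport_solution (T : R) (b : R -> 'rV[R]_n -> 'rV[R]_n)
    (w : R -> 'rV[R]_n) (v0 : 'rV[R]_n -> R) (v : R -> 'rV[R]_n -> R) :=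
  essentially_bounded T v /\
  exists2 D, is_divergence T b D &
    forall theta, test_function theta ->
    let F := transport_integrand (fun t x => b t x + derive1 w t) D v theta in
    lebTx.-integrable (strip T) (EFin \o F) /\
    {ae leb, forall t, t \in `[0, T] ->
      \int[lebn]_x (v t x * theta x) =
        \int[lebn]_x (v0 x * theta x) + \int[lebTx]_(p in strip t) F p}.

Definition unique_transport_solution (T : R) (b : R -> 'rV[R]_n -> 'rV[R]_n)
    (w : R -> 'rV[R]_n) (v0 : 'rV[R]_n -> R) (v : R -> 'rV[R]_n -> R) :=
  transport_solution T b w v0 v /\
  forall v', transport_solution T b w v0 v' ->
    {ae lebTx, forall p, strip T p -> v' p.1 p.2 = v p.1 p.2}.

(* X' = b(t, X) + w' on [s, T], X(s) = x, in integrated form. *)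
Definition integral_solution (b : R -> 'rV[R]_n -> 'rV[R]_n) (w : R -> 'rV[R]_n)
    (s T : R) (x : 'rV[R]_n) (X : R -> 'rV[R]_n) :=
  {within `[s, T], continuous X} /\
  forall t, t \in `[s, T] ->
    X t = x + \row_i (\int[leb]_(r in `[s, t]) (b r (X r) ord0 i)) + (w t - w s).

Record ode_flow (T : R) (b : R -> 'rV[R]_n -> 'rV[R]_n) (w : R -> 'rV[R]_n)
    (psi : R -> 'rV[R]_n -> 'rV[R]_n) : Prop := {
  ode_flow_solution : forall x, integral_solution b w 0 T x (psi ^~ x) ;
  ode_flow_unique : forall x X, integral_solution b w 0 T x X ->
    forall t, t \in `[0, T] -> X t = psi t x ;
  ode_flow_homeomorphism : forall t, t \in `[0, T] -> homeomorphism (psi t) }.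

End analysis_on_Rn.

Section stochastic.
Context {R : realType} (n : nat) (disp : measure_display)
  (Omega : measurableType disp) (P : probability Omega R).
Local Notation leb := (@lebesgue_measure R).
Local Notation lebn := (@lebesgue_rV R n).
Local Notation lebTx := (leb \x lebn)%E.

(* Convergence to 0 in probability of nonnegative functions. The outer measure
   agrees with P on events, and makes sense for functions that are measurable
   only up to a P-null set. *)
Definition vanishes_in_probability (Z : nat -> Omega -> \bar R) :=
  forall eps : R, 0 < eps ->
    mu_ext P [set omega | eps%:E <= Z m omega]%E @[m --> \oo] --> 0%E.

Definition cvg_in_probability (X : nat -> Omega -> R) (Y : Omega -> R) :=
  vanishes_in_probability (fun m omega => `|X m omega - Y omega|%:E).

Definition cvg_in_probability_C0 (T : R) (X : nat -> R -> Omega -> 'rV[R]_n)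
    (Y : R -> Omega -> 'rV[R]_n) :=
  vanishes_in_probability (fun m omega =>
    ereal_sup [set `|X m t omega - Y t omega|%:E | t in `[0, T]]).

Definition is_filtration (T : R) (F : R -> set (set Omega)) :=
  [/\ forall t, t \in `[0, T] -> sigma_algebra setT (F t),
      forall t, t \in `[0, T] -> F t `<=` measurable &
      forall s t, 0 <= s -> s <= t -> t <= T -> F s `<=` F t].

Definition adapted_on (F : R -> set (set Omega)) (s T : R) d'
    (E : measurableType d') (X : R -> Omega -> E) :=
  forall t, t \in `[s, T] -> forall B, measurable B -> F t (X t @^-1` B).

(* Increments over [s, t] are independent of F_s with law N(0, (t - s) Id). *)
Record brownian_motion (T : R) (F : R -> set (set Omega))
    (W : R -> Omega -> 'rV[R]_n) : Prop := {
  bm_adapted : adapted_on F 0 T W ;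
  bm_start : {ae P, forall omega, W 0 omega = 0} ;
  bm_continuous : {ae P, forall omega, {within `[0, T], continuous (W ^~ omega)}} ;
  bm_increments : forall s t, 0 <= s -> s < t -> t <= T ->
    forall A, F s A -> forall B : 'I_n -> set R, (forall i, measurable (B i)) ->
    P (A `&` [set omega | forall i, B i ((W t omega - W s omega) ord0 i)]) =
      (P A * \prod_(i < n) normal_prob 0%R (Num.sqrt (t - s)) (B i))%E }.

Definition simplex (T : R) : set (R * R * 'rV[R]_n) :=
  [set p | [/\ 0 <= p.1.1, p.1.1 <= p.1.2 & p.1.2 <= T]].

(* phi s t omega x is the position at time t of the solution of
   dX = b(t, X) dt + dW started from x at time s. *)
Record stochastic_flow (T : R) (F : R -> set (set Omega))
    (b : R -> 'rV[R]_n -> 'rV[R]_n) (W : R -> Omega -> 'rV[R]_n)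
    (phi : R -> R -> Omega -> 'rV[R]_n -> 'rV[R]_n) : Prop := {
  flow_adapted : forall s x, s \in `[0, T] ->
    adapted_on F s T (fun t omega => phi s t omega x) ;
  flow_solution : forall s x, s \in `[0, T] ->
    {ae P, forall omega,
      integral_solution b (W ^~ omega) s T x (fun t => phi s t omega x)} ;
  flow_unique : forall s x (X : R -> Omega -> 'rV[R]_n), s \in `[0, T] ->
    adapted_on F s T X ->
    {ae P, forall omega, integral_solution b (W ^~ omega) s T x (X ^~ omega)} ->
    {ae P, forall omega, forall t, t \in `[s, T] -> X t omega = phi s t omega x} ;
  flow_diffeomorphism : {ae P, forall omega, forall s t,
    0 <= s -> s <= t -> t <= T -> C1_diffeomorphism (phi s t omega)} ;
  flow_continuous : {ae P, forall omega,
    [/\ {within simplex T, continuous (fun p => phi p.1.1 p.1.2 omega p.2)},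
        {within simplex T,
          continuous (fun p => inverse (phi p.1.1 p.1.2 omega) p.2)},
        {within simplex T, continuous (fun p => jacobian (phi p.1.1 p.1.2 omega) p.2)} &
        {within simplex T,
          continuous (fun p => jacobian (inverse (phi p.1.1 p.1.2 omega)) p.2)}]} ;
  flow_cocycle : {ae P, forall omega, forall s r t,
    0 <= s -> s <= r -> r <= t -> t <= T ->
    phi s t omega = phi r t omega \o phi s r omega} ;
  flow_id : {ae P, forall omega, forall s, s \in `[0, T] ->
    phi s s omega = id} }.

(* I is the Stratonovich integral of Y against Z over [0, t]: the limit in
   probability of the symmetrised Riemann sums along any sequence of partitions
   0 = c_0 < ... < c_k = t with mesh tending to 0. *)
Definition stratonovich_integral (Y Z : R -> Omega -> R) (t : R)
    (I : Omega -> R) :=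
  forall s : nat -> seq R,
    (forall m, itv_partition 0 t (s m)) ->
    (forall delta, 0 < delta -> \forall m \near \oo, forall k,
      (k < size (s m))%N -> (0 :: s m)`_k.+1 - (0 :: s m)`_k <= delta) ->
    cvg_in_probability
      (fun m omega => \sum_(k < size (s m))
        let c := (0 :: s m)`_k in let c' := (0 :: s m)`_k.+1 in
        (Y c omega + Y c' omega) / 2 * (Z c' omega - Z c omega))
      I.

(* v is a weak L^oo solution of
   d_t v + b . Dv dt + sum_i e_i . Dv o dW^i = 0, v(0) = v0, with divb = div b;
   Y i is the process (\int v(t, x) D_i theta(x) dx)_t and S i t its
   Stratonovich integral against W^i over [0, t]. *)
Definition stratonovich_transport_solution (T : R) (F : R -> set (set Omega))
    (b : R -> 'rV[R]_n -> 'rV[R]_n) (divb : R -> 'rV[R]_n -> R)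
    (W : R -> Omega -> 'rV[R]_n) (v0 : 'rV[R]_n -> R)
    (v : R -> 'rV[R]_n -> Omega -> R) :=
  {ae P, forall omega, essentially_bounded T (fun t x => v t x omega)} /\
  forall theta, test_function theta ->
  exists Y S : 'I_n -> R -> Omega -> R,
  [/\ forall i, adapted_on F 0 T (Y i),
      forall i, {ae P, forall omega, {within `[0, T], continuous (Y i ^~ omega)} /\
        forall t, t \in `[0, T] ->
          Y i t omega = \int[lebn]_x (v t x omega * partial i theta x)},
      forall i t, t \in `[0, T] ->
        stratonovich_integral (Y i) (fun r omega => W r omega ord0 i) t (S i t) &
      {ae P, forall omega,
        let G := transport_integrand b divb (fun t x => v t x omega) theta in
        lebTx.-integrable (strip T) (EFin \o G) /\
        forall t, t \in `[0, T] ->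
          \int[lebn]_x (v t x omega * theta x) =
            \int[lebn]_x (v0 x * theta x) + \int[lebTx]_(p in strip t) G p
            + \sum_(i < n) S i t omega}].

End stochastic.

(* Main.v *)
Require Import Defs.
From HB Require Import structures.
From mathcomp Require Import all_boot all_order all_algebra.
From mathcomp Require Import all_classical all_reals all_analysis.
From mathcomp Require Import measurable_realfun lra ring.
Import Order.TTheory GRing.Theory Num.Theory.
Import numFieldNormedType.Exports.

(* The curve X_n(s) = varphi_n,s(y_n), y_n = varphi_n,t^-1(x), ends at x at
   time t. It solves the equation with drift b and driving path W + Z_n, where
   Z_n = W_n - W + \int (b_n - b)(r, X_n(r)) dr is uniformly small with high
   probability. Over a time step of length h it leaves the flow phi by at most
   O(|Z_n|) + K h (2 M h + O(|Z_n|))^alpha, since b is alpha-Hoelder, and phi is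
   locally Lipschitz in space uniformly in time. So s |-> phi_s,t(X_n(s)) moves
   by O(N |Z_n| + N^-alpha) over N steps; letting first n and then N tend to
   infinity gives phi_0,t(y_n) -> x, hence y_n -> phi_0,t^-1(x). The constants
   that depend on omega (bound on W, Lipschitz constant of phi, modulus of
   u_0 o phi_0,t^-1 at x) are controlled outside events of small probability,
   which are made measurable by quantifying over rational points only. *)

Set Implicit Arguments.
Unset Strict Implicit.
Unset Printing Implicit Defensive.

Local Open Scope classical_set_scope.
Local Open Scope ring_scope.

(** * Row vectors *)

Section row_vectors.
Context {R : realType} {n : nat}.
Implicit Types (v x y : 'rV[R]_n) (c r : R).

Lemma rV_norm_leP v c : 0 <= c ->
  reflect (forall i, `|v ord0 i| <= c) (`|v| <= c).
Proof.
move=> c0; rewrite [X in X <= _]/Num.Def.normr/= mx_normrE.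
apply: (iffP (bigmax_leP _ _ _ _)).
  by move=> [_ h] i; exact: (h (ord0, i) isT).
by move=> h; split => // -[i j] _; rewrite /= (ord1 i); exact: h.
Qed.

Lemma rV_norm_ltP v c : 0 < c ->
  reflect (forall i, `|v ord0 i| < c) (`|v| < c).
Proof.
move=> c0; rewrite [X in X < _]/Num.Def.normr/= mx_normrE.
apply: (iffP (bigmax_ltP _ _ _ _)).
  by move=> [_ h] i; exact: (h (ord0, i) isT).
by move=> h; split => // -[i j] _; rewrite /= (ord1 i); exact: h.
Qed.

Lemma rV_coord_le_norm v i : `|v ord0 i| <= `|v|.
Proof. by have /rV_norm_leP := lexx `|v|; apply. Qed.

Lemma open_norm_gt c : open [set v : 'rV[R]_n | c < `|v|].
Proof.
rewrite (_ : mkset _ = Num.norm @^-1` [set a | c < a]) //.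
by apply: open_comp; [move=> v _; exact: norm_continuous|exact: open_gt].
Qed.

Lemma compact_norm_le c : compact [set v : 'rV[R]_n | `|v| <= c].
Proof.
apply: bounded_closed_compact.
  exists c; split; first exact: num_real.
  by move=> a ca v /= vc; rewrite (le_trans vc)// ltW.
rewrite (_ : mkset _ = ~` [set v | c < `|v|]).
  by apply: open_closedC; exact: open_norm_gt.
by apply/seteqP; split => v /=; rewrite leNgt => /negP.
Qed.

(** A dense family indexed by a [countType], so that events quantified over it fall under
    [measurable_bigcup_count]. *)
Definition rV_rat (q : 'rV[rat]_n) : 'rV[R]_n := map_mx ratr q.

Lemma rV_rat_dense v r : 0 < r -> exists q, `|v - rV_rat q| < r.
Proof.
move=> r0.
have h i : exists q : rat, `|v ord0 i - ratr q| < r.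
  have /rat_in_itvoo[q] : v ord0 i - r < v ord0 i + r by lra.
  rewrite in_itv/= => /andP[h1 h2]; exists q.
  by rewrite ltr_norml; lra.
exists (\row_i projT1 (cid (h i))); apply/rV_norm_ltP => // i.
by rewrite !mxE; exact: (projT2 (cid (h i))).
Qed.

Lemma rV_rat_nbhs v (U : set 'rV[R]_n) : nbhs v U -> exists q, U (rV_rat q).
Proof.
move=> /nbhs_ballP[e /= e0 eU]; have [q qe] := @rV_rat_dense v _ e0.
by exists q; apply: eU; rewrite -ball_normE.
Qed.

(** The points of the open ball where [g] is positive form an open set, which would contain a
    rational point if it were nonempty. The strict bound on the norm is what makes it open. *)
Lemma rV_rat_le0 (g : 'rV[R]_n -> R) r : continuous g ->
  (forall q, `|rV_rat q| < r -> g (rV_rat q) <= 0) ->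
  forall x, `|x| < r -> g x <= 0.
Proof.
move=> cg gq x xr; rewrite leNgt; apply/negP => gx.
have [q [/= qr]] : exists q, [set y | `|y| < r /\ 0 < g y] (rV_rat q).
  apply: (@rV_rat_nbhs x); apply: filterI.
    exact: (@norm_continuous _ 'rV[R]_n x _ (lt_nbhsl xr)).
  exact: (cg x _ (lt_nbhsr gx)).
by rewrite ltNge gq.
Qed.

(** Mean value theorem for each coordinate along the segment from [y] to [x], which stays in the
    ball by convexity. The factor [n] comes from summing [n] products of entries, each bounded
    through the sup norm. *)
Lemma jacobian_lipschitz (f : 'rV[R]_n -> 'rV[R]_n) r J :
  (forall x, differentiable f x) ->
  (forall x, `|x| <= r -> `|jacobian f x| <= J) ->
  forall x y, `|x| <= r -> `|y| <= r -> `|f x - f y| <= n%:R * J * `|x - y|.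
Proof.
move=> df Jf x y xr yr.
have J0 : 0 <= J by apply: le_trans (Jf _ xr).
apply/rV_norm_leP => [|i]; first by rewrite !mulr_ge0.
pose l (s : R) := y + s *: (x - y).
have dl (s : R) : is_diff s l (fun h : R => h *: (x - y)).
  apply: DiffDef; first by [].
  by apply/funext => h; rewrite diff_val/= add0r.
pose g (s : R) := f (l s) ord0 i.
have dg (s : R) : is_derive s 1 g (((x - y) *m jacobian f (l s)) ord0 i).
  have dfl : differentiable (f \o l) s by apply: differentiable_comp.
  have dg : derivable (f \o l) s 1 by exact: diff_derivable.
  have gij := (derivable_mxP _ _ _).1 dg ord0 i.
  apply: DeriveDef => //.
  have -> : 'D_1 g s = ('D_1 (f \o l) s) ord0 i by rewrite derive_mx// mxE.
  rewrite deriveE// diff_comp//= diff_val scale1r /jacobian.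
  by rewrite mul_rV_lin1.
have cg : {within `[0, 1], continuous g}.
  apply: continuous_subspaceT => s.
  by apply: differentiable_continuous; apply/derivable1_diffP; case: (dg s).
have [s s01] := @MVT_segment R g _ 0 1 ler01 (fun s _ => dg s) cg.
have l1 : l 1 = x by rewrite /l scale1r addrC subrK.
have l0 : l 0 = y by rewrite /l scale0r addr0.
rewrite subr0 mulr1 /g l1 l0 => gE.
rewrite 2!mxE gE mxE (le_trans (ler_norm_sum _ _ _))//.
have ls : `|l s| <= r.
  have -> : l s = (1 - s) *: y + s *: x.
    by rewrite /l scalerBr scalerBl scale1r addrA addrAC.
  move: s01; rewrite in_itv/= => /andP[s0 s1].
  rewrite (le_trans (ler_normD _ _))// !normrZ.
  rewrite (ger0_norm s0) ger0_norm ?subr_ge0//.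
  have := ler_wpM2l s0 xr.
  have := @ler_wpM2l _ (1 - s) (ltac:(by rewrite subr_ge0)) _ _ yr.
  lra.
apply: (@le_trans _ _ (\sum_(j < n) `|x - y| * J)).
  apply: ler_sum => j _; rewrite normrM ler_pM//.
    exact: rV_coord_le_norm.
  rewrite (le_trans _ (Jf _ ls))// [leRHS]/Num.Def.normr/= mx_normrE.
  by apply/bigmax_geP; right; exists (j, i).
by rewrite sumr_const card_ord -mulr_natl; lra.
Qed.

End row_vectors.

(** * Measurability and bounds for integrals *)

Section countable.
Context d (E : measurableType d) (I : countType).

Lemma measurable_bigcap_count (A : I -> set E) :
  (forall i, measurable (A i)) -> measurable [set x | forall i, A i x].
Proof.
move=> mA.
rewrite (_ : mkset _ = \bigcap_k (if unpickle k is Some i then A i else setT)).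
  by apply: bigcapT_measurable => k; case: unpickle.
apply/seteqP; split => [x /= Ax k _|x Ax i]; first by case: unpickle => [i|].
by have := Ax (pickle i) Logic.I; rewrite pickleK.
Qed.

Lemma measurable_bigcup_count (A : I -> set E) :
  (forall i, measurable (A i)) -> measurable [set x | exists i, A i x].
Proof.
move=> mA; rewrite (_ : mkset _ = ~` [set x | forall i, (~` A i) x]).
  by apply/measurableC/measurable_bigcap_count => i; exact: measurableC.
apply/seteqP; split => [x [i Ai] /(_ i)//|x /existsNP[i /contrapT Ai]].
by exists i.
Qed.

Lemma ae_forall_count {R : realType} (mu : {measure set E -> \bar R})
    (Q : I -> E -> Prop) :
  (forall i, {ae mu, forall x, Q i x}) -> {ae mu, forall x i, Q i x}.
Proof.
move=> hQ.
have : {ae mu, forall x k, if unpickle k is Some i then Q i x else True}.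
  by apply: ae_foralln => k; case: unpickle => [i|]; [exact: hQ|exact: aeW].
by apply: filterS => x /= + i => /(_ (pickle i)); rewrite pickleK.
Qed.

End countable.

Lemma measurable_fun_pair_in d d1 d2 (E : measurableType d)
    (E1 : measurableType d1) (E2 : measurableType d2) (D : set E)
    (f : E -> E1) (g : E -> E2) :
  measurable D -> measurable_fun D f -> measurable_fun D g ->
  measurable_fun D (fun x => (f x, g x)).
Proof.
move=> mD mf mg.
apply: (measurability (preimage_set_system setT fst measurable `|`
                       preimage_set_system setT snd measurable)) => //.
move=> _ [_ [[B mB <-]|[B mB <-]] <-]; rewrite setTI.
- exact: mf.
- exact: mg.
Qed.

Section rV_measurability.
Context {R : realType} {n : nat}.

Lemma measurable_rV_coord (i : 'I_n) :
  measurable_fun setT (fun v : 'rV[R]_n => v ord0 i).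
Proof.
by move=> _ B mB; rewrite setTI; apply: sub_sigma_algebra; exists i, B.
Qed.

Lemma measurable_fun_rV d (E : measurableType d) (D : set E)
    (f : E -> 'rV[R]_n) :
  measurable D -> (forall i, measurable_fun D (fun e => f e ord0 i)) ->
  measurable_fun D f.
Proof.
move=> mD mf; apply: (@measurability _ _ _ _ _ _ (@rV_cylinder R n)) => //.
by move=> _ [_ [i [B mB ->]] <-]; exact: mf.
Qed.

Lemma measurable_coord_fun d (E : measurableType d) (D : set E)
    (f : E -> 'rV[R]_n) i :
  measurable_fun D f -> measurable_fun D (fun e => f e ord0 i).
Proof. by move=> mf; exact: (measurableT_comp (measurable_rV_coord i)). Qed.

(** The sigma-algebra is generated by coordinates rather than by open sets, so the argument goes
    through sublevel sets: those of the sup norm are finite intersections of coordinate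
    conditions. *)
Lemma measurable_rV_norm : measurable_fun setT (fun v : 'rV[R]_n => `|v|).
Proof.
apply: (measurability _ (RGenInftyO.measurableE R)).
move=> _ [_ [c ->] <-]; rewrite setTI.
have [c0|c0] := ltP 0 c; last first.
  rewrite (_ : _ @^-1` _ = set0)//; apply/seteqP; split => // v /=.
  by rewrite in_itv/= => /(le_lt_trans (normr_ge0 v)); rewrite ltNge c0.
rewrite (_ : _ @^-1` _ =
    [set v : 'rV[R]_n | forall i, [set v | `|v ord0 i| < c] v]).
  apply: measurable_bigcap_count => i.
  rewrite -[X in measurable X]setTI.
  have := @measurableT_comp _ _ _ _ _ _ _ _ _
    (@normr_measurable R setT) (measurable_rV_coord i).
  by move=> /(_ measurableT _ (measurable_itv `]-oo, c[)); rewrite set_itvE.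
by apply/seteqP; split => v /=; rewrite in_itv/= => /(rV_norm_ltP _ c0).
Qed.

Lemma measurable_fun_rVB d (E : measurableType d) (D : set E)
    (f g : E -> 'rV[R]_n) : measurable D ->
  measurable_fun D f -> measurable_fun D g ->
  measurable_fun D (fun e => f e - g e).
Proof.
move=> mD mf mg; apply: measurable_fun_rV => // i.
under eq_fun do rewrite !mxE.
by apply: measurable_funB; exact: measurable_coord_fun.
Qed.

Lemma measurable_fun_norm_rVB d (E : measurableType d) (D : set E)
    (f g : E -> 'rV[R]_n) : measurable D ->
  measurable_fun D f -> measurable_fun D g ->
  measurable_fun D (fun e => `|f e - g e|).
Proof.
move=> mD mf mg; apply: (measurableT_comp measurable_rV_norm).
exact: measurable_fun_rVB.
Qed.

Lemma within_continuous_measurable_rV (s r : R) (X : R -> 'rV[R]_n) :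
  {within `[s, r], continuous X} -> measurable_fun `[s, r] X.
Proof.
move=> cX; apply: measurable_fun_rV => // i.
apply: subspace_continuous_measurable_fun => //.
move=> x; apply: (@continuous_comp (subspace `[s, r]) _ _ X
  (fun v : 'rV[R]_n => v ord0 i)); [exact: cX|exact: coord_continuous].
Qed.

Lemma measurable_field_along T (b : R -> 'rV[R]_n -> 'rV[R]_n) s r
    (X : R -> 'rV[R]_n) :
  measurable_fun (strip T) (fun p : R * 'rV[R]_n => b p.1 p.2) ->
  0 <= s -> r <= T -> measurable_fun `[s, r] X ->
  measurable_fun `[s, r] (fun v => b v (X v)).
Proof.
move=> mb s0 rT mX.
apply: (@measurable_comp _ _ _ _ _ _ (strip T) (fun p => b p.1 p.2) `[s, r]
  (fun v => (v, X v))) => //.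
- exact: measurableX.
- move=> _ [v /= + <-]; rewrite in_itv/= => /andP[sv vr].
  by split=> //=; rewrite in_itv/= (le_trans s0 sv) (le_trans vr rT).
- exact: measurable_fun_pair_in.
Qed.

End rV_measurability.

(** * Bounds for integrals over segments *)

Section integrals.
Context {R : realType}.
Local Notation leb := (@lebesgue_measure R).

Lemma lebesgue_segment (s r : R) : s <= r -> leb `[s, r] = (r - s)%:E.
Proof.
move=> sr; rewrite lebesgue_measure_itv/= lte_fin.
by move: sr; rewrite le_eqVlt => /predU1P[->|->//]; rewrite ltxx subrr.
Qed.

Lemma bounded_integrable (s r c : R) (g : R -> R) :
  measurable_fun `[s, r] g -> (forall v, v \in `[s, r] -> `|g v| <= c) ->
  leb.-integrable `[s, r] (EFin \o g).
Proof.
move=> mg gc; apply: measurable_bounded_integrable => //.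
  have [sr|sr] := leP s r; last first.
    by rewrite set_itv_ge ?measure0// bnd_simp -ltNge.
  by rewrite [ltLHS]lebesgue_segment// ltry.
exists c; split; first exact: num_real.
by move=> y cy v /= vsr; rewrite (le_trans (gc _ vsr))// ltW.
Qed.

Lemma norm_Rintegral_le (s r c : R) (g : R -> R) : s <= r ->
  measurable_fun `[s, r] g -> (forall v, v \in `[s, r] -> `|g v| <= c) ->
  `|\int[leb]_(v in `[s, r]) g v| <= c * (r - s).
Proof.
move=> sr mg gc; apply: (le_trans (le_normr_Rintegral _ _)) => //.
  exact: bounded_integrable gc.
have -> : c * (r - s) = \int[leb]_(v in `[s, r]) c.
  by rewrite Rintegral_cst// [X in fine X]lebesgue_segment.
apply: le_Rintegral => //.
- apply: (@bounded_integrable _ _ c); first exact: measurableT_comp.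
  by move=> v /gc; rewrite normr_id.
- by apply: (@bounded_integrable _ _ `|c|).
Qed.

(** The integrand is dominated by [e + C * \1_A]. Here [A] stands for a small set of times on which
    only the crude bound [C] is available. *)
Lemma norm_Rintegral_le_except (s r e C : R) (A : set R) (g : R -> R) :
  s <= r -> 0 <= C -> measurable A -> measurable_fun `[s, r] g ->
  (forall v, v \in `[s, r] -> `|g v| <= C) ->
  (forall v, v \in `[s, r] -> ~ A v -> `|g v| <= e) -> 0 <= e ->
  `|\int[leb]_(v in `[s, r]) g v| <=
    e * (r - s) + C * fine (leb (`[s, r] `&` A)).
Proof.
move=> sr C0 mA mg gC ge e0; apply: (le_trans (le_normr_Rintegral _ _)) => //.
  exact: bounded_integrable gC.
have mC : measurable_fun `[s, r] (fun v => C * \1_A v : R).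
  by apply: measurable_funM => //; exact: measurable_indic.
have iC : leb.-integrable `[s, r] (EFin \o (fun v => C * \1_A v)).
  apply: (@bounded_integrable _ _ C) => // v _.
  rewrite normrM (ger0_norm C0) ger0_norm ?indicE ?ler0n//.
  by case: (v \in A); rewrite ?mulr1 ?mulr0.
have ic : leb.-integrable `[s, r] (EFin \o (fun=> e)).
  by apply: (@bounded_integrable _ _ `|e|).
have -> : e * (r - s) + C * fine (leb (`[s, r] `&` A)) =
    \int[leb]_(v in `[s, r]) (e + C * \1_A v).
  rewrite RintegralD//; congr (_ + _).
    by rewrite Rintegral_cst// [X in fine X]lebesgue_segment.
  rewrite RintegralZl//; last first.
    apply: (@bounded_integrable _ _ 1) => // v _.
    by rewrite ger0_norm ?indicE ?ler0n//; case: (v \in A).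
  by rewrite /Rintegral integral_indic// setIC.
apply: le_Rintegral => //.
- apply: (@bounded_integrable _ _ C); first exact: measurableT_comp.
  by move=> v /gC; rewrite normr_id.
- apply: (@bounded_integrable _ _ (e + C)); first exact: measurable_funD.
  move=> v _; rewrite ger0_norm ?addr_ge0 ?mulr_ge0 ?indicE//.
  by rewrite lerD2l; case: (v \in A); rewrite ?mulr1 ?mulr0.
- move=> v vsr; rewrite indicE; have [vA|/negP vA] := boolP (v \in A).
    by rewrite mulr1 (le_trans (gC _ vsr))// lerDr.
  by rewrite mulr0 addr0 ge// => /mem_set.
Qed.

End integrals.

(** * Perturbed solutions and the flow *)

Section rV_integral.
Context {R : realType} {n : nat}.
Local Notation leb := (@lebesgue_measure R).
Implicit Types (s r c : R) (g h : R -> 'rV[R]_n).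

Definition rV_integral s r g : 'rV[R]_n :=
  \row_i \int[leb]_(v in `[s, r]) g v ord0 i.

Lemma rV_integral_le s r c g : s <= r -> 0 <= c -> measurable_fun `[s, r] g ->
  (forall v, v \in `[s, r] -> `|g v| <= c) ->
  `|rV_integral s r g| <= c * (r - s).
Proof.
move=> sr c0 mg gc; apply/rV_norm_leP => [|i].
  by rewrite mulr_ge0// subr_ge0.
rewrite mxE; apply: norm_Rintegral_le => //; first exact: measurable_coord_fun.
by move=> v /gc; apply: le_trans; exact: rV_coord_le_norm.
Qed.

Lemma rV_integral_le_except s r e C (A : set R) g : s <= r -> 0 <= C ->
  0 <= e -> measurable A -> measurable_fun `[s, r] g ->
  (forall v, v \in `[s, r] -> `|g v| <= C) ->
  (forall v, v \in `[s, r] -> ~ A v -> `|g v| <= e) ->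
  `|rV_integral s r g| <= e * (r - s) + C * fine (leb (`[s, r] `&` A)).
Proof.
move=> sr C0 e0 mA mg gC ge; apply/rV_norm_leP => [|i].
  by rewrite addr_ge0// mulr_ge0// ?subr_ge0// fine_ge0.
rewrite mxE; apply: norm_Rintegral_le_except => //.
- exact: measurable_coord_fun.
- by move=> v /gC; apply: le_trans; exact: rV_coord_le_norm.
- by move=> v vsr Av; apply: le_trans (ge v vsr Av); exact: rV_coord_le_norm.
Qed.

Lemma rV_integrableP s r c g i : measurable_fun `[s, r] g ->
  (forall v, v \in `[s, r] -> `|g v| <= c) ->
  leb.-integrable `[s, r] (EFin \o (fun v => g v ord0 i)).
Proof.
move=> mg gc; apply: (@bounded_integrable _ _ _ c).
  exact: measurable_coord_fun.
by move=> v /gc; apply: le_trans; exact: rV_coord_le_norm.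
Qed.

Lemma rV_integralB s r c c' g h :
  measurable_fun `[s, r] g -> measurable_fun `[s, r] h ->
  (forall v, v \in `[s, r] -> `|g v| <= c) ->
  (forall v, v \in `[s, r] -> `|h v| <= c') ->
  rV_integral s r (fun v => g v - h v) = rV_integral s r g - rV_integral s r h.
Proof.
move=> mg mh gc hc; apply/rowP => i; rewrite !mxE.
under eq_Rintegral do rewrite !mxE.
by rewrite RintegralB//; [exact: rV_integrableP gc|exact: rV_integrableP hc].
Qed.

Lemma rV_integral_incr s r r' c g : s <= r -> r <= r' ->
  measurable_fun `[s, r'] g -> (forall v, v \in `[s, r'] -> `|g v| <= c) ->
  rV_integral s r' g - rV_integral s r g = rV_integral r r' g.
Proof.
move=> sr rr' mg gc; apply/rowP => i; rewrite !mxE.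
have ig := rV_integrableP i mg gc.
rewrite (@Rintegral_itvB _ (fun v => g v ord0 i) (BLeft s) (BRight r') r)//.
(* The subtraction leaves the interval open at [r]; adding this null endpoint does not change the
   integral. *)
apply: Rintegral_itv_obnd_cbnd; apply: integrableS ig => //.
by apply: subset_itvr; rewrite bnd_simp.
Qed.

End rV_integral.

(** * Equations in increment form, the one-step estimate and its sum over a grid *)

Section increments.
Context {R : realType} {n : nat}.
Local Notation leb := (@lebesgue_measure R).
Variables (T M : R).
Hypothesis M0 : 0 <= M.
Implicit Types (b : R -> 'rV[R]_n -> 'rV[R]_n) (w X Y Z : R -> 'rV[R]_n).

Definition bounded_field b :=
  measurable_fun (strip T) (fun p : R * 'rV[R]_n => b p.1 p.2) /\
  forall r x, r \in `[0, T] -> `|b r x| <= M.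

(* [X' = b(t, X) + w'] on [[s, T]], written through increments so that neither
   the starting point nor [w s] has to be singled out. *)
Definition solves b w s X := measurable_fun `[s, T] X /\
  forall r r', s <= r -> r <= r' -> r' <= T ->
    X r' - X r = rV_integral r r' (fun v => b v (X v)) + (w r' - w r).

Lemma field_along b s r X : bounded_field b -> 0 <= s -> r <= T ->
  measurable_fun `[s, r] X ->
  measurable_fun `[s, r] (fun v => b v (X v)) /\
  forall v, v \in `[s, r] -> `|b v (X v)| <= M.
Proof.
move=> [mb bM] s0 rT mX; split; first exact: measurable_field_along mb _ _ _.
move=> v; rewrite in_itv/= => /andP[sv vr]; apply: bM.
by rewrite in_itv/= (le_trans s0)//= (le_trans vr).
Qed.

Lemma solves_sub b w s X r r' : solves b w s X -> s <= r -> r' <= T ->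
  measurable_fun `[r, r'] X.
Proof.
move=> [mX _] sr rT; apply: measurable_funS mX => //.
by apply: subset_itv; rewrite bnd_simp.
Qed.

Lemma integral_solution_solves b w s x X : bounded_field b -> 0 <= s ->
  s <= T -> integral_solution b w s T x X -> solves b w s X /\ X s = x.
Proof.
move=> fb s0 sT [cX XE].
have mX := within_continuous_measurable_rV cX.
have [mbX bXM] := field_along fb s0 (lexx T) mX.
split; last first.
  rewrite XE ?in_itv/= ?lexx// subrr addr0 -[RHS]addr0; congr (_ + _).
  by apply/rowP => i; rewrite !mxE set_itv1 Rintegral_set1.
split=> // r r' sr rr' rT; rewrite !XE ?in_itv/= ?sr ?rT ?(le_trans sr)//=;
  last exact: le_trans rT.
rewrite -(@rV_integral_incr _ _ s r r' M)//.
- rewrite /rV_integral.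
  move: (\row_i _) (\row_i _) => a c; rewrite [in RHS]addrC.
  by apply/rowP => i; rewrite !mxE; ring.
- by apply: measurable_funS mbX => //; apply: subset_itvl; rewrite bnd_simp.
- move=> v; rewrite in_itv/= => /andP[sv vr']; apply: bXM.
  by rewrite in_itv/= sv (le_trans vr').
Qed.

(** Adding and subtracting [b] along [X] moves the difference of the drifts into the driving path.
    The sum is left unsimplified so that the perturbation of [w] can be read off as a single
    term. *)
Lemma solves_perturb b b' w w' X : bounded_field b -> bounded_field b' ->
  solves b' w' 0 X ->
  solves b (fun r => w r + (w' r - w r +
    rV_integral 0 r (fun v => b' v (X v) - b v (X v)))) 0 X.
Proof.
move=> fb fb' [mX XE]; split => // r r' r0 rr' rT.
have r'0 := le_trans r0 rr'.
have sol : solves b' w' 0 X by split.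
have [m1 h1] := field_along fb (lexx 0) rT (solves_sub sol (lexx 0) rT).
have [m2 h2] := field_along fb' (lexx 0) rT (solves_sub sol (lexx 0) rT).
have [m3 h3] := field_along fb r0 rT (solves_sub sol r0 rT).
have [m4 h4] := field_along fb' r0 rT (solves_sub sol r0 rT).
have m5 : measurable_fun `[0, r'] (fun v => b' v (X v) - b v (X v)).
  exact: measurable_fun_rVB.
have h5 v : v \in `[0, r'] -> `|b' v (X v) - b v (X v)| <= M + M.
  by move=> v0; rewrite (le_trans (ler_normB _ _))// lerD ?h1 ?h2.
have := rV_integral_incr r0 rr' m5 h5.
rewrite (rV_integralB m4 m3 h4 h3) XE// => /eqP.
rewrite eq_sym subr_eq => /eqP incr.
by rewrite incr; apply/rowP => i; rewrite !mxE; ring.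
Qed.

Definition grid (t : R) (N k : nat) : R := t * k%:R / N%:R.

Section step.
Variables (K alpha : R) (b : R -> 'rV[R]_n -> 'rV[R]_n).
Hypotheses (K0 : 0 <= K) (alpha0 : 0 < alpha) (fb : bounded_field b).
Hypothesis bK : forall r x y, r \in `[0, T] ->
  `|b r x - b r y| <= K * `|x - y| `^ alpha.

(** A bootstrap: boundedness of the drift gives the crude bound [rho], which is then inserted in the
    Hoelder estimate to gain the power [alpha]. In [3 * zeta], one [zeta] is the initial distance
    and two come from the increment of [Z]. *)
Lemma solves_near w X Y Z s s' zeta : 0 <= s -> s <= s' -> s' <= T ->
  solves b (fun r => w r + Z r) 0 X -> solves b w s Y ->
  (forall r, r \in `[0, T] -> `|Z r| <= zeta) ->
  `|X s - Y s| <= zeta ->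
  let rho := 3 * zeta + 2 * M * (s' - s) in
  `|X s' - Y s'| <= rho /\
  `|X s' - Y s'| <= 3 * zeta + (s' - s) * (K * rho `^ alpha).
Proof.
move=> s0 ss' s'T sX sY Zz XYs rho.
have ze0 : 0 <= zeta by apply: le_trans XYs.
have mX r : r <= T -> measurable_fun `[s, r] X.
  by move=> rT; exact: solves_sub sX _ _.
have mY r : r <= T -> measurable_fun `[s, r] Y.
  by move=> rT; exact: solves_sub sY _ _.
(* The common path [w] cancels, so its roughness does not enter the estimate. *)
have decomp r : s <= r -> r <= T -> X r - Y r = (X s - Y s) + (Z r - Z s) +
    (rV_integral s r (fun v => b v (X v)) -
     rV_integral s r (fun v => b v (Y v))).
  move=> sr rT.
  have -> : X r = X s + (X r - X s) by rewrite addrC subrK.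
  have -> : Y r = Y s + (Y r - Y s) by rewrite addrC subrK.
  rewrite (sX.2 s r)// (sY.2 s r)//.
  by apply/rowP => i; rewrite !mxE; ring.
have start r : s <= r -> r <= T -> `|(X s - Y s) + (Z r - Z s)| <= 3 * zeta.
  move=> sr rT; rewrite (le_trans (ler_normD _ _))//.
  have h1 := Zz s (ltac:(by rewrite in_itv/= s0 (le_trans sr))).
  have h2 := Zz r (ltac:(by rewrite in_itv/= rT (le_trans s0))).
  have := ler_normB (Z r) (Z s).
  lra.
have far r : s <= r -> r <= s' -> `|X r - Y r| <= rho.
  move=> sr rs'; have rT := le_trans rs' s'T.
  rewrite decomp// (le_trans (ler_normD _ _))// /rho lerD ?start//.
  have [m1 h1] := field_along fb s0 rT (mX _ rT).
  have [m2 h2] := field_along fb s0 rT (mY _ rT).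
  have := rV_integral_le sr M0 m1 h1.
  have := rV_integral_le sr M0 m2 h2.
  have := ler_normB (rV_integral s r (fun v => b v (X v)))
    (rV_integral s r (fun v => b v (Y v))).
  have : M * (r - s) <= M * (s' - s) by rewrite ler_wpM2l// lerB.
  lra.
split; first exact: far.
rewrite decomp// (le_trans (ler_normD _ _))// lerD ?start//.
have [m1 h1] := field_along fb s0 s'T (mX _ s'T).
have [m2 h2] := field_along fb s0 s'T (mY _ s'T).
rewrite -(rV_integralB m1 m2 h1 h2) [leRHS]mulrC.
apply: rV_integral_le => //.
- by rewrite mulr_ge0// powR_ge0.
- exact: measurable_fun_rVB.
- move=> v; rewrite in_itv/= => /andP[sv vs'].
  rewrite (le_trans (bK _ _ _))//.
    by rewrite in_itv/= (le_trans s0)//= (le_trans vs').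
  rewrite ler_wpM2l// ge0_ler_powR ?nnegrE ?far//; first exact: ltW.
  by rewrite (le_trans _ (far v sv vs')).
Qed.

(* [phi] is Lipschitz in space while a time step of length [h] perturbs [X] off
   the flow by only [O(zeta + h ^ (1 + alpha))], so [s |-> phi s t (X s)] is
   almost constant. *)
Lemma flow_telescope (phi : R -> R -> 'rV[R]_n -> 'rV[R]_n) w X Z t N zeta r L :
  let s k := grid t N k in
  let rho := 3 * zeta + 2 * M * (t / N%:R) in
  0 <= t <= T -> (0 < N)%N -> 0 < zeta -> 0 <= L -> rho <= 1 ->
  (forall k q, (k <= N)%N -> let y := rV_rat q in
    solves b w (s k) (fun v => phi (s k) v y) /\ phi (s k) (s k) y = y) ->
  (forall k x y, (k <= N)%N -> `|x| < r -> `|y| < r ->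
    `|phi (s k) t x - phi (s k) t y| <= L * `|x - y|) ->
  (forall k x, (k < N)%N ->
    phi (s k) t x = phi (s k.+1) t (phi (s k) (s k.+1) x)) ->
  (forall x, phi t t x = x) ->
  solves b (fun v => w v + Z v) 0 X ->
  (forall v, v \in `[0, T] -> `|Z v| <= zeta) ->
  (forall k, (k <= N)%N -> `|X (s k)| + 1 < r) ->
  `|phi 0 t (X 0) - X t| <=
    N%:R * (L * (4 * zeta + t / N%:R * (K * rho `^ alpha))).
Proof.
move=> s rho /andP[t0 tT] N0 z0 L0 rho1 solphi lip coc phid solX Zz Xr.
have s0 : s 0%N = 0 by rewrite /s /grid mulr0 mul0r.
have sN : s N = t by rewrite /s /grid mulfK// pnatr_eq0 -lt0n.
have sS k : s k.+1 - s k = t / N%:R.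
  by rewrite /s /grid -mulrBl -mulrBr -natrB// subSnn mulr1.
have tN0 : 0 <= t / N%:R by rewrite divr_ge0.
have s_ge0 k : 0 <= s k by rewrite /s /grid divr_ge0// mulr_ge0.
have s_leS k : s k <= s k.+1 by rewrite -subr_ge0 sS.
have s_leT k : (k <= N)%N -> s k <= T.
  move=> kN; rewrite (le_trans _ tT)// /s /grid.
  by rewrite ler_pdivrMr ?ltr0n// ler_wpM2l// ler_nat.
have z1 : zeta <= 1.
  have : 0 <= 2 * M * (t / N%:R) by rewrite !mulr_ge0.
  by rewrite /rho in rho1; lra.
pose e := L * (4 * zeta + t / N%:R * (K * rho `^ alpha)).
have step k : (k < N)%N ->
    `|phi (s k) t (X (s k)) - phi (s k.+1) t (X (s k.+1))| <= e.
  (* The equation of the flow is at hand only for rational starting points, so [X (s k)] is first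
     replaced by one. This costs [L * zeta], whence [4 * zeta] instead of [3 * zeta] in [e]. *)
  move=> kN; have [q qz] := rV_rat_dense (X (s k)) z0.
  have [solY Y0] := solphi k q (ltnW kN).
  have := solves_near (s_ge0 k) (s_leS k) (s_leT _ kN) solX solY Zz.
  rewrite /= sS Y0 => /(_ (ltW qz)) [far near].
  set y := phi (s k) (s k.+1) (rV_rat q) in far near.
  (* The margin 1 in [Xr], with [rho <= 1], keeps [y] in the ball where [lip] holds; [zeta <= 1]
     does the same for the rational point. *)
  have yr : `|y| < r.
    have := Xr _ kN; have := ler_normB (X (s k.+1)) (X (s k.+1) - y).
    rewrite subKr; rewrite /rho in rho1; lra.
  have qr : `|rV_rat q : 'rV[R]_n| < r.
    have := Xr _ (ltnW kN); have := ler_normB (X (s k)) (X (s k) - rV_rat q).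
    rewrite subKr; lra.
  have Xr1 j : (j <= N)%N -> `|X (s j)| < r by move=> /Xr; lra.
  have h1 := lip k _ _ (ltnW kN) (Xr1 _ (ltnW kN)) qr.
  have h2 := lip k.+1 _ _ kN (Xr1 _ kN) yr.
  have := ler_distD (phi (s k) t (rV_rat q)) (phi (s k) t (X (s k)))
    (phi (s k.+1) t (X (s k.+1))).
  rewrite [X in _ + `|X - _|]coc// -/y (distrC (phi (s k.+1) t y)) => h3.
  have h4 := ler_wpM2l L0 (ltW qz).
  have h5 := ler_wpM2l L0 near.
  rewrite /e /rho; lra.
have tele k : (k <= N)%N ->
    `|phi 0 t (X 0) - phi (s k) t (X (s k))| <= k%:R * e.
  elim: k => [|k IH] kN; first by rewrite s0 subrr normr0 mul0r.
  have := ler_distD (phi (s k) t (X (s k))) (phi 0 t (X 0))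
    (phi (s k.+1) t (X (s k.+1))).
  by have := IH (ltnW kN); have := step k kN; rewrite -natr1; lra.
by have := tele N (leqnn N); rewrite sN phid.
Qed.

(** The order of choice matters: first a size [c] for [rho] that makes the Hoelder term small, then
    [N] to bring the step part of [rho] below [c / 2], and last [zeta], which must beat the factor
    [N]. *)
Lemma stability_parameters t L eps : 0 <= t -> 0 <= L -> 0 < eps ->
  exists N zeta, [/\ (0 < N)%N, 0 < zeta,
    3 * zeta + 2 * M * (t / N%:R) <= 1 &
    N%:R * (L * (4 * zeta + t / N%:R *
      (K * (3 * zeta + 2 * M * (t / N%:R)) `^ alpha))) <= eps].
Proof.
move=> t0 L0 e0.
pose C := L * t * K + 1.
have C0 : 0 < C by rewrite ltr_wpDl// !mulr_ge0.
pose c := Num.min 1 ((eps / 2 / C) `^ alpha^-1).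
have c0 : 0 < c by rewrite lt_min ltr01 powR_gt0// !divr_gt0.
have c1 : c <= 1 by rewrite /c ge_min lexx.
have cC : c `^ alpha <= eps / 2 / C.
  have -> : eps / 2 / C = ((eps / 2 / C) `^ alpha^-1) `^ alpha.
    by rewrite -powRrM mulVf ?lt0r_neq0// powRr1// !divr_ge0// ltW.
  rewrite ge0_ler_powR ?nnegrE ?powR_ge0 ?(ltW c0)//;
    first exact: ltW.
  by rewrite /c ge_min lexx orbT.
pose N := (Num.truncn (4 * M * t / c)).+1.
have N0 : 0 < N%:R :> R by rewrite ltr0n.
have hN : 2 * M * (t / N%:R) <= c / 2.
  have : 4 * M * t / c < N%:R by rewrite truncnS_gt.
  rewrite ltr_pdivrMr// => h; rewrite mulrA ler_pdivrMr//; lra.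
(* The first bound gives [3 * zeta <= c / 2], the second [4 * N * L * zeta <= eps / 2]; the added 1
   keeps the denominator positive. *)
pose zeta := Num.min (c / 6) (eps / (8 * (N%:R * L + 1))).
have NL0 : 0 < 8 * (N%:R * L + 1).
  by rewrite mulr_gt0// ltr_wpDl// mulr_ge0// ltW.
have z0 : 0 < zeta by rewrite lt_min !divr_gt0.
have z1 : zeta <= c / 6 by rewrite /zeta ge_min lexx.
have z2 : zeta * (8 * (N%:R * L + 1)) <= eps.
  by rewrite -ler_pdivlMr// /zeta ge_min lexx orbT.
have rhoc : 3 * zeta + 2 * M * (t / N%:R) <= c by lra.
exists N, zeta; split => //; first lra.
set p := _ `^ alpha.
have pc : p <= eps / 2 / C.
  apply: le_trans cC; rewrite ge0_ler_powR ?nnegrE ?(ltW c0)//;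
    first exact: ltW.
  by rewrite addr_ge0 ?mulr_ge0 ?divr_ge0 ?(ltW z0)// ltW.
have p0 : 0 <= p by exact: powR_ge0.
(* The number of steps cancels against the step length in the Hoelder term and survives only in
   front of [zeta]. *)
have -> : N%:R * (L * (4 * zeta + t / N%:R * (K * p))) =
    4 * (N%:R * L * zeta) + L * t * K * p.
  by field; exact: lt0r_neq0.
have h1 : 4 * (N%:R * L * zeta) <= eps / 2 by lra.
have h2 : L * t * K * p <= eps / 2.
  apply: (@le_trans _ _ (C * p)); first by rewrite /C; lra.
  by rewrite mulrC -ler_pdivlMr.
lra.
Qed.

End step.

End increments.

(** * Convergence in probability *)

Section vanishing.
Context {R : realType}.

Lemma cvge0P (f : nat -> \bar R) : (forall m, 0 <= f m)%E ->
  f @ \oo --> 0%E <->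
  forall d : R, 0 < d -> \forall m \near \oo, (f m <= d%:E)%E.
Proof.
move=> f0; split=> [/fine_cvgP[ff /cvgrPdist_le cf] d d0|h].
  near=> m; rewrite -[f m]fineK; last by near: m.
  rewrite lee_fin; have : `|0 - (fine \o f) m| <= d by near: m; exact: cf.
  by rewrite sub0r normrN; apply: le_trans; rewrite ler_norm.
have ff d m : (f m <= d%:E)%E -> f m \is a fin_num.
  by move=> fd; rewrite ge0_fin_numE// (le_lt_trans fd)// ltry.
apply/fine_cvgP; split; first by near=> m; apply: (ff 1); near: m; exact: h.
apply/cvgrPdist_le => d d0; near=> m.
have fd : (f m <= d%:E)%E by near: m; exact: h.
rewrite sub0r normrN /= ger0_norm ?fine_ge0// -lee_fin fineK//; exact: ff fd.
Unshelve. all: by end_near. Qed.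

Context d (E : measurableType d).

(** Continuity from above: almost every point leaves the decreasing sequence, so its intersection is
    null. It serves both for sets of times and for events. *)
Lemma null_bigcap_small (mu : {measure set E -> \bar R}) (A : nat -> set E) :
  (mu (A 0%N) < +oo)%E -> (forall k, measurable (A k)) ->
  (forall j k, (j <= k)%N -> A k `<=` A j) ->
  {ae mu, forall x, exists k, ~ A k x} ->
  forall e : R, 0 < e -> exists k, (mu (A k) <= e%:E)%E.
Proof.
move=> A0 mA decA aeA e e0.
have mcap : measurable (\bigcap_k A k) by exact: bigcapT_measurable.
have niA : nonincreasing_seq A by move=> j k jk; apply/subsetPset; exact: decA.
have := nonincreasing_cvg_mu A0 mA mcap niA.
have -> : mu (\bigcap_k A k) = 0%E.
  apply/(negligibleP _ mcap); apply: negligibleS aeA => x Ax [k]; apply.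
  exact: Ax.
move=> /cvge0P/(_ e e0)[]; first by move=> m; exact: measure_ge0.
by move=> k _ /(_ k (leqnn k)) ?; exists k.
Qed.

Lemma mu_ext_negligible (mu : {measure set E -> \bar R}) (A : set E) :
  mu.-negligible A -> mu_ext mu A = 0%E.
Proof.
move=> [N [mN muN AN]]; apply/eqP; rewrite eq_le mu_ext_ge0 ?andbT//.
by rewrite -muN -(measurable_mu_extE mu mN) le_mu_ext.
Qed.

(** The event where [Z m] is large is covered by [B], the event where [Z' m] is at least [eta], and
    a null set. Only the null set may depend on [m]. Subadditivity of the outer measure avoids any
    measurability of [Z]. *)
Lemma vanishes_in_probability_dominated (P : probability E R)
    (Z Z' : nat -> E -> \bar R) :
  vanishes_in_probability P Z' ->
  (forall e p : R, 0 < e -> 0 < p -> exists B eta,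
    [/\ measurable B, (P B <= p%:E)%E, 0 < eta &
      \forall m \near \oo, {ae P, forall x, ~ B x ->
        (Z' m x < eta%:E)%E -> (Z m x < e%:E)%E}]) ->
  vanishes_in_probability P Z.
Proof.
move=> vZ' h e e0; apply/cvge0P => [m|p p0]; first exact: mu_ext_ge0.
have p20 : 0 < p / 2 by rewrite divr_gt0.
have [B [eta [mB PB eta0 hB]]] := h e _ e0 p20.
have /cvge0P/(_ _ p20) hZ' := vZ' eta eta0.
near=> m.
have aeG : {ae P, forall x, ~ B x -> (Z' m x < eta%:E)%E -> (Z m x < e%:E)%E}.
  by near: m.
pose G := [set x | ~ B x -> (Z' m x < eta%:E)%E -> (Z m x < e%:E)%E].
have sub : [set x | (e%:E <= Z m x)%E] `<=`
    B `|` [set x | (eta%:E <= Z' m x)%E] `|` ~` G.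
  move=> x /= eZ; rewrite -[X in X \/ _]/(B x \/ _) -orA.
  have [Bx|nBx] := pselect (B x); [by left|right].
  rewrite leNgt; have [Z'x|_] := boolP (Z' m x < _)%E; [right|by left].
  by move=> /(_ nBx Z'x); rewrite ltNge eZ.
apply: le_trans (le_mu_ext P sub) _.
apply: le_trans (outer_measureU2 (mu_ext P) _ _) _.
rewrite [X in (_ + X)%E]mu_ext_negligible// adde0.
apply: le_trans (outer_measureU2 (mu_ext P) _ _) _.
rewrite (splitr p) EFinD leeD//.
  by rewrite [leLHS]measurable_mu_extE.
by near: m; apply: hZ' => m; exact: mu_ext_ge0.
Unshelve. all: by end_near. Qed.

End vanishing.

(** * Convergence of the drifts *)

Section drift.
Context {R : realType} {n : nat}.
Local Notation leb := (@lebesgue_measure R).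
Variables (T M : R) (b : R -> 'rV[R]_n -> 'rV[R]_n).
Variable bn : nat -> R -> 'rV[R]_n -> 'rV[R]_n.
Hypotheses (T0 : 0 <= T) (M0 : 0 <= M).
Hypothesis fb : bounded_field T M b.
Hypothesis fbn : forall m, bounded_field T M (bn m).
Hypothesis cb : forall v, v \in `[0, T] -> continuous (b v).

Lemma uniform_closed_ball (v r e : R) : 0 < e ->
  {family compact, (fun m => bn m v) @ \oo --> b v} ->
  \forall m \near \oo, forall y, `|y| <= r -> `|bn m v y - b v y| < e.
Proof.
move=> e0 /fam_cvgP/(_ [set y | `|y| <= r]).
move=> /(_ (@compact_norm_le _ _ r)) cvg; have := cvg
  [set h | forall y, `|y| <= r -> ball (b v y) e (h y)].
rewrite /= => -[].
  apply/uniform_nbhs; exists [set xy | ball xy.1 e xy.2]; split => //.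
  exact: (entourage_ball _ (PosNum e0)).
move=> k _ hk; exists k => // m /hk/= h y /h.
by rewrite -ball_normE/= distrC.
Qed.

Hypothesis bnc : {ae leb, forall v, v \in `[0, T] ->
  (forall m, C1b (bn m v)) /\
  {family compact, (fun m => bn m v) @ \oo --> b v}}.

(** Restricting to rational points makes this set of times measurable, and the intersection with
    [[0, T]] gives it finite measure. *)
Let far (r e : R) (m : nat) : set R :=
  [set v | exists q : 'rV[rat]_n, (`[0, T] `&`
    [set v | `|rV_rat q : 'rV[R]_n| < r /\
             e < `|bn m v (rV_rat q) - b v (rV_rat q)|]) v].

Let measurable_far r e m : measurable (far r e m).
Proof.
apply: measurable_bigcup_count => q.
have [qr|qr] := boolP (`|rV_rat q : 'rV[R]_n| < r); last first.
  rewrite (_ : _ `&` _ = set0); first exact: measurable0.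
  by apply/seteqP; split => // v [_ [qr' _]]; case/negP: qr.
have mq : measurable_fun `[0, T] (fun v =>
    `|bn m v (rV_rat q) - b v (rV_rat q)|).
  have h (f : R -> 'rV[R]_n -> 'rV[R]_n) : bounded_field T M f ->
      measurable_fun `[0, T] (fun v => f v (rV_rat q)).
    move=> ff; exact: (field_along ff (lexx 0) (lexx T)
      (@measurable_cst _ _ _ _ _ (rV_rat q))).1.
  by apply: measurable_fun_norm_rVB => //; apply: h.
have := mq (measurable_itv _) _ (measurable_itv `]e, +oo[).
congr measurable; apply/seteqP; split => v /=.
  by move=> [? h]; split => //; move: h; rewrite in_itv/= andbT.
by move=> [? [_ h]]; split => //; rewrite in_itv/= andbT.
Qed.

(** An argument of Egorov type: outside a set of times of small measure the drifts are uniformly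
    close on the ball, for all large [m]. Since the ball is fixed, the rank of [m] does not depend
    on the curve [X]. *)
Lemma drift_integral_small (r e : R) : 0 < e ->
  \forall m \near \oo, forall X : R -> 'rV[R]_n, measurable_fun `[0, T] X ->
    (forall v, v \in `[0, T] -> `|X v| < r) -> forall s, s \in `[0, T] ->
    `|rV_integral 0 s (fun v => bn m v (X v) - b v (X v))| <= e.
Proof.
move=> e0.
(* [e1] over a length at most [T] contributes [e / 2], and so does the crude bound [M + M] over a
   set of measure [e2]. *)
pose e1 := e / (2 * (T + 1)); pose e2 := e / (4 * (M + 1)).
have e10 : 0 < e1 by rewrite divr_gt0// mulr_gt0// ltr_wpDl.
have e20 : 0 < e2 by rewrite divr_gt0// mulr_gt0// ltr_wpDl.
pose A k := \bigcup_(m in [set m | (k <= m)%N]) far r e1 m.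
have mA k : measurable (A k) by exact: bigcup_measurable.
have A_T k : A k `<=` `[0, T] by move=> v [m _ [q []]].
have [k Ak] : exists k, (leb (A k) <= e2%:E)%E.
  apply: null_bigcap_small e20 => //.
  - apply: (@le_lt_trans _ _ (leb `[0, T])).
      apply: le_measure; [| |exact: A_T].
        by rewrite inE; exact: mA.
      by rewrite inE; exact: measurable_itv.
    by rewrite [ltLHS]lebesgue_segment// ltry.
  - by move=> j k jk v [m /= km fm]; exists m => //=; exact: leq_trans km.
  - apply: negligibleS bnc => v; apply: contra_not => /= hv.
    have [vT|vT] := boolP (v \in `[0, T]); last first.
      by exists 0%N => -[m _ [q []]]; rewrite /= (negbTE vT).
    have [j _ hj] := uniform_closed_ball r e10 (hv vT).2.
    by exists j => -[m /= /hj h [q [_ [/ltW/h /ltW]]]]; rewrite leNgt => /negP.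
(* Times in [N] are also excepted: there [bn m v] might be discontinuous, and rational points would
   say nothing about [X v]. *)
have [N [mN N0 hN]] := bnc.
exists k => // m /= km X mX Xr s s0T.
have [s0 sT] : 0 <= s /\ s <= T by move: s0T; rewrite in_itv/= => /andP.
have mX' : measurable_fun `[0, s] X.
  by apply: measurable_funS mX => //; apply: subset_itvl; rewrite bnd_simp.
have [m1 h1] := field_along fb (lexx 0) sT mX'.
have [m2 h2] := field_along (fbn m) (lexx 0) sT mX'.
have MM0 : 0 <= M + M by rewrite addr_ge0.
apply: (le_trans (rV_integral_le_except (A := A k `|` N) s0 MM0 (ltW e10)
  _ _ _ _)).
- exact: measurableU.
- exact: measurable_fun_rVB.
- by move=> v vs; rewrite (le_trans (ler_normB _ _))// lerD ?h1 ?h2.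
(* By contraposition: a distance greater than [e1] at [X v] persists at a nearby rational point of
   the ball, which puts [v] in [far r e1 m]. *)
- move=> v vs; apply: contra_notP => /negP; rewrite -ltNge => ev.
  have vT : v \in `[0, T].
    by move: vs; rewrite !in_itv/= => /andP[-> /le_trans]; exact.
  have [Nv|Nv] := pselect (N v); [by right|left].
  have [cbn _] : (forall m, C1b (bn m v)) /\
      {family compact, (fun m => bn m v) @ \oo --> b v}.
    have [h|h] := pselect (v \in `[0, T] -> (forall m, C1b (bn m v)) /\
      {family compact, (fun m => bn m v) @ \oo --> b v}); first exact: h.
    by exfalso; apply: Nv; exact: hN.
  have cbv : continuous (fun y => bn m v y - b v y).
    move=> y; apply: continuousB; last exact: cb.
    by apply: differentiable_continuous; have [[]] := cbn m.
  have nv : nbhs (bn m v (X v) - b v (X v)) [set z : 'rV[R]_n | e1 < `|z|].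
    by apply: open_nbhs_nbhs; split=> //; exact: open_norm_gt.
  have rX : 0 < r - `|X v| by rewrite subr_gt0 Xr.
  have [q [qX eq]] := rV_rat_nbhs (filterI (nbhsx_ballx _ _ rX) (cbv _ _ nv)).
  move: qX; rewrite -ball_normE/= => qX.
  exists m => //; exists q; split => //; split => //.
  have := ler_normB (X v) (X v - rV_rat q); rewrite subKr; lra.
have mU : measurable (A k `|` N) by exact: measurableU.
have mI : measurable (`[0, s] `&` (A k `|` N)).
  by apply: measurableI => //; exact: measurable_itv.
have lebU : fine (leb (`[0, s] `&` (A k `|` N))) <= e2.
  rewrite -lee_fin fineK; last first.
    rewrite ge0_fin_numE// (@le_lt_trans _ _ (leb `[0, s]))//.
      apply: le_measure; [| |exact: subIsetl]; rewrite inE; first exact: mI.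
      exact: measurable_itv.
    by rewrite [ltLHS]lebesgue_segment// ltry.
  apply: (@le_trans _ _ (leb (A k `|` N))).
    apply: le_measure; [| |exact: subIsetr]; rewrite inE; first exact: mI.
    exact: mU.
  apply: (@le_trans _ _ (leb (A k) + leb N)%E).
    by apply: measureU2; [exact: mA|exact: mN].
  by rewrite [X in (_ + X)%E]N0 adde0.
have h1' : e1 * (s - 0) <= e / 2.
  apply: (@le_trans _ _ (e1 * (T + 1))); first by rewrite ler_wpM2l ?ltW//; lra.
  by rewrite /e1 le_eqVlt; apply/orP; left; apply/eqP; field; lra.
have h2' : (M + M) * fine (leb (`[0, s] `&` (A k `|` N))) <= e / 2.
  apply: (@le_trans _ _ ((M + 1) * 2 * e2)).
    by rewrite ler_pM// ?fine_ge0//; lra.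
  by rewrite /e2 le_eqVlt; apply/orP; left; apply/eqP; field; lra.
by rewrite (splitr e) lerD.
Qed.

End drift.

(** * Exceptional events *)

Section events.
Context {R : realType} {n : nat} (disp : measure_display)
  (Omega : measurableType disp) (P : probability Omega R).
Variables (T : R) (F : R -> set (set Omega)).
Hypothesis hF : is_filtration T F.

Lemma adapted_measurable s (X : R -> Omega -> 'rV[R]_n) r :
  0 <= s -> adapted_on F s T X -> r \in `[s, T] -> measurable_fun setT (X r).
Proof.
move=> s0 aX rsT _ B mB; rewrite setTI.
have [_ FT _] := hF; apply: (FT r); last exact: aX.
by move: rsT; rewrite !in_itv/= => /andP[/(le_trans s0) -> ->].
Qed.

Lemma measurable_norm_lt (X Y : Omega -> 'rV[R]_n) c :
  measurable_fun setT X -> measurable_fun setT Y ->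
  measurable [set omega | `|X omega - Y omega| < c].
Proof.
move=> mX mY.
have := measurable_fun_norm_rVB measurableT mX mY.
move=> /(_ measurableT _ (measurable_itv `]-oo, c[)); rewrite setTI.
by congr measurable; apply/seteqP; split => omega /=; rewrite in_itv.
Qed.

Lemma measurable_norm_gt (X Y : Omega -> 'rV[R]_n) c :
  measurable_fun setT X -> measurable_fun setT Y ->
  measurable [set omega | c < `|X omega - Y omega|].
Proof.
move=> mX mY.
have := measurable_fun_norm_rVB measurableT mX mY.
move=> /(_ measurableT _ (measurable_itv `]c, +oo[)); rewrite setTI.
by congr measurable; apply/seteqP; split => omega /=; rewrite in_itv/= andbT.
Qed.

(** [Q] gathers the almost sure regularity, so that each application only has to find [k] for one
    regular [omega]. *)
Lemma bad_event_small (A : nat -> set Omega) (Q : set Omega) :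
  (forall k, measurable (A k)) ->
  (forall j k, (j <= k)%N -> A k `<=` A j) ->
  {ae P, forall omega, Q omega -> exists k, ~ A k omega} ->
  {ae P, forall omega, Q omega} ->
  forall p : R, 0 < p -> exists k, (P (A k) <= p%:E)%E.
Proof.
move=> mA decA aeA aeQ; apply: null_bigcap_small => //.
  by rewrite (le_lt_trans (probability_le1 _ _))// ltry.
by move: aeQ aeA; apply: filterS2 => omega Qo; apply.
Qed.

(** A continuous path is bounded on [[0, T]], so it leaves the events of exceeding [k] at a rational
    time. Outside such an event, continuity carries the bound to all times. *)
Lemma path_bounded_outside (W : R -> Omega -> 'rV[R]_n) p : 0 < T -> 0 < p ->
  adapted_on F 0 T W ->
  {ae P, forall omega, {within `[0, T], continuous (W ^~ omega)}} ->
  exists (k : nat) (B : set Omega), [/\ measurable B, (P B <= p%:E)%E &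
    {ae P, forall omega, ~ B omega ->
      forall s, s \in `[0, T] -> `|W s omega| <= k%:R}].
Proof.
move=> T0 p0 aW cW.
pose A (k : nat) : set Omega := [set omega | exists q : rat,
  (if ratr q \in `[0, T] then [set omega | k%:R < `|W (ratr q) omega - 0|]
   else set0) omega].
have mA k : measurable (A k).
  apply: measurable_bigcup_count => q; case: ifPn => // qT.
  by apply: measurable_norm_gt => //; apply: adapted_measurable aW qT.
have [] := @bad_event_small A _ mA _ _ cW p p0.
- move=> j k jk omega [q Hq]; exists q; move: Hq; case: ifPn => // _ /=.
  by apply: le_lt_trans; rewrite ler_nat.
- apply: aeW => omega cWo.
  have [M [_ hM]] := compact_bounded
    (continuous_compact cWo (@segment_compact _ _ _)).
  (* Boundedness is phrased as a bound by every number above [M], so [M + 1] is used in place of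
     [M]. *)
  exists (Num.truncn (M + 1)).+1 => -[q]; case: ifPn => //= qT.
  rewrite subr0; apply/negP; rewrite -leNgt.
  apply: le_trans (ltW (truncnS_gt (M + 1))).
  by apply: (hM (M + 1)); [rewrite ltrDl|exists (ratr q)].
move=> k Ak; exists k, (A k); split => //.
move: cW; apply: filterS => omega cWo nA s s0T.
rewrite leNgt; apply/negP => ks.
have nks : nbhs (W s omega) [set v : 'rV[R]_n | k%:R < `|v|].
  by apply: open_nbhs_nbhs; split=> //; exact: open_norm_gt.
have /subspace_continuousP/(_ s s0T) cs := cWo.
have /nbhs_ballP[e /= e0 he] := cs _ nks.
(* Thanks to [0 < T] this interval is nonempty even when [s] is an endpoint of [[0, T]]. *)
have h1 : Num.max 0 (s - e) < Num.min T (s + e).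
  move: s0T; rewrite in_itv/= => /andP[s0 sT].
  rewrite lt_min !gt_max; lra.
have [q] := rat_in_itvoo h1.
rewrite in_itv/= gt_max lt_min => /andP[/andP[q0 qs] /andP[qT qs']].
have qI : ratr q \in `[0, T] by rewrite in_itv/= !ltW.
apply: nA; exists q; rewrite qI /= subr0; apply: he => //=.
by rewrite -ball_normE/= ltr_distlC; lra.
Qed.

(** * Regularity of the stochastic flow outside small events *)

Section flow.
Variables (b : R -> 'rV[R]_n -> 'rV[R]_n) (W : R -> Omega -> 'rV[R]_n).
Variable phi : R -> R -> Omega -> 'rV[R]_n -> 'rV[R]_n.
Hypothesis hphi : stochastic_flow P T F b W phi.

Lemma grid_itv (t : R) N k : 0 <= t -> (0 < N)%N -> (k <= N)%N ->
  0 <= grid t N k <= t.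
Proof.
move=> t0 N0 kN; rewrite divr_ge0 ?mulr_ge0//= ler_pdivrMr ?ltr0n//.
by rewrite ler_wpM2l// ler_nat.
Qed.

(** The Jacobian is continuous, hence bounded, on the compact set of starting times in [[0, t]] and
    points of the ball. One constant thus serves all grids, which is essential because [N] is chosen
    after it. *)
Lemma flow_lipschitz_outside t r p : t \in `[0, T] -> 0 < p ->
  exists (j : nat) (B : set Omega), [/\ measurable B, (P B <= p%:E)%E &
    {ae P, forall omega, ~ B omega -> forall N k x y, (0 < N)%N -> (k <= N)%N ->
      `|x| < r -> `|y| < r ->
      `|phi (grid t N k) t omega x - phi (grid t N k) t omega y| <=
        j%:R * `|x - y|}].
Proof.
move=> tT p0; have [t0 tleT] : 0 <= t /\ t <= T.
  by move: tT; rewrite in_itv => /andP.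
pose ok (i : nat * nat * 'rV[rat]_n * 'rV[rat]_n) :=
  [&& (0 < i.1.1.1)%N, (i.1.1.2 <= i.1.1.1)%N,
     `|rV_rat i.1.2 : 'rV[R]_n| < r & `|rV_rat i.2 : 'rV[R]_n| < r].
pose phi' (i : nat * nat * 'rV[rat]_n * 'rV[rat]_n) q omega :=
  phi (grid t i.1.1.1 i.1.1.2) t omega (rV_rat q).
pose A (j : nat) : set Omega := [set omega | exists i,
  (if ok i then [set omega | j%:R * `|rV_rat i.1.2 - rV_rat i.2 : 'rV[R]_n| <
     `|phi' i i.1.2 omega - phi' i i.2 omega|] else set0) omega].
pose Q omega := (forall s u, 0 <= s -> s <= u -> u <= T ->
    C1_diffeomorphism (phi s u omega)) /\
  {within simplex T,
    continuous (fun p => jacobian (phi p.1.1 p.1.2 omega) p.2)}.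
have mA j : measurable (A j).
  apply: measurable_bigcup_count => i; case: ifPn => // /and4P[N0 kN _ _].
  have /andP[s0 st] := grid_itv t0 N0 kN.
  have st' : t \in `[grid t i.1.1.1 i.1.1.2, T] by rewrite in_itv/= st.
  have sT : grid t i.1.1.1 i.1.1.2 \in `[0, T].
    by rewrite in_itv/= s0 (le_trans st).
  have mphi q : measurable_fun setT (phi' i q).
    exact: (adapted_measurable s0 (flow_adapted hphi (rV_rat q) sT) st').
  by apply: measurable_norm_gt; exact: mphi.
have aeQ : {ae P, forall omega, Q omega}.
  have := flow_continuous hphi; have := flow_diffeomorphism hphi.
  by apply: filterS2 => omega h [_ _ h' _].
have [] := @bad_event_small A Q mA _ _ aeQ p p0.
- move=> j k jk omega [i Hi]; exists i; move: Hi; case: ifPn => // _ /=.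
  by apply: le_lt_trans; rewrite ler_wpM2r// ler_nat.
- apply: aeW => omega [diffeo cjac].
  pose K : set (R * R * 'rV[R]_n) :=
    (`[0, t] `*` [set t]) `*` [set y | `|y| <= r].
  have KS : K `<=` simplex T.
    move=> [[s u] y] [[/= + ->] _]; rewrite in_itv/= => /andP[s0 st].
    by split.
  have cK : compact K.
    apply: compact_setX; last exact: compact_norm_le.
    by apply: compact_setX; [exact: segment_compact|exact: compact_set1].
  have [M [_ hM]] := compact_bounded
    (continuous_compact (continuous_subspaceW KS cjac) cK).
  exists (Num.truncn (n%:R * (M + 1))).+1 => -[i].
  case: ifPn => //= /and4P[N0 kN xr yr]; apply/negP; rewrite -leNgt.
  have /andP[s0 st] := grid_itv t0 N0 kN.
  have [_ [dphi _] _] := diffeo _ _ s0 st tleT.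
  apply: (le_trans (jacobian_lipschitz (J := M + 1) dphi _ (ltW xr) (ltW yr))).
    move=> y yr'; apply: (hM (M + 1)); first by rewrite ltrDl.
    exists ((grid t i.1.1.1 i.1.1.2, t), y) => //; split => //=; split => //=.
    by rewrite in_itv/= s0.
  by rewrite ler_wpM2r// ltW// truncnS_gt.
move=> j PA; exists j, (A j); split => //.
move: aeQ; apply: filterS => omega [diffeo _] nA N k x y N0 kN xr yr.
have /andP[s0 st] := grid_itv t0 N0 kN.
have [_ [dphi _] _] := diffeo _ _ s0 st tleT.
set f := phi (grid t N k) t omega in dphi *.
have cf : continuous f by move=> z; exact: differentiable_continuous.
pose g (a c : 'rV[R]_n) := `|f a - f c| - j%:R * `|a - c|.
have cg (h h' : 'rV[R]_n -> 'rV[R]_n) : continuous h -> continuous h' ->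
    continuous (fun z => g (h z) (h' z)).
  move=> ch ch' z.
  have c1 : {for z, continuous (fun z => f (h z) - f (h' z))}.
    apply: continuousB.
      exact: (continuous_comp (ch z) (cf (h z))).
    exact: (continuous_comp (ch' z) (cf (h' z))).
  have c2 : {for z, continuous (fun z => h z - h' z)}.
    by apply: continuousB; [exact: ch|exact: ch'].
  have c3 := continuous_comp c1 (@norm_continuous _ _ _).
  have c4 := continuous_comp c2 (@norm_continuous _ _ _).
  have c5 : {for z, continuous (fun z => j%:R * `|h z - h' z|)}.
    exact: (cvgMl_tmp (a := j%:R) c4).
  by apply: (cvgB c3 c5).
have gqq q q' : `|rV_rat q : 'rV[R]_n| < r -> `|rV_rat q' : 'rV[R]_n| < r ->
    g (rV_rat q) (rV_rat q') <= 0.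
  move=> qr qr'; rewrite subr_le0 leNgt; apply/negP => bad; apply: nA.
  by exists (N, k, q, q'); rewrite /ok/= N0 kN qr qr'; exact: bad.
(* The inequality passes from rational pairs to all pairs one variable at a time. *)
rewrite -subr_le0; apply: (@rV_rat_le0 _ _ (g ^~ y) r) => //.
  by apply: (cg id (cst y)); [move=> z; exact: cvg_id|exact: cst_continuous].
move=> q qr; apply: (@rV_rat_le0 _ _ (g (rV_rat q)) r) => //.
  apply: (cg (cst (rV_rat q)) id); first exact: cst_continuous.
  by move=> z; exact: cvg_id.
by move=> q' qr'; exact: gqq.
Qed.

(** Every fibre is nonempty, so the choice in [inverse] lands in it instead of falling back on the
    default 0. *)
Lemma inverseK (f : 'rV[R]_n -> 'rV[R]_n) : bijective f ->
  cancel f (inverse f) /\ cancel (inverse f) f.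
Proof.
move=> [g gK Kg].
have fK : cancel (inverse f) f.
  move=> y; apply: (xgetPex 0 (P := f @^-1` [set y])).
  by exists (g y); exact: Kg.
by split=> // x; apply: (can_inj gK); rewrite fK.
Qed.

(** This is continuity at [x] of [u0] composed with the inverse flow, written through the forward
    flow. The exceptional events then involve only [phi 0 t] at rational points, which is measurable
    by adaptedness. *)
Lemma inverse_flow_modulus (u0 : 'rV[R]_n -> R) t x e p :
  continuous u0 -> t \in `[0, T] -> 0 < e -> 0 < p ->
  exists (rho : R) (B : set Omega), [/\ 0 < rho, measurable B,
    (P B <= p%:E)%E &
    {ae P, forall omega, ~ B omega -> forall y y',
      `|phi 0 t omega y - x| < rho -> `|phi 0 t omega y' - x| < rho ->
      `|u0 y - u0 y'| <= e}].
Proof.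
move=> cu0 tT e0 p0; have [t0 tleT] : 0 <= t /\ t <= T.
  by move: tT; rewrite in_itv => /andP.
pose A (j : nat) : set Omega := [set omega | exists i : 'rV[rat]_n * 'rV[rat]_n,
  (if e < `|u0 (rV_rat i.1) - u0 (rV_rat i.2)| then
     [set omega | `|phi 0 t omega (rV_rat i.1) - x| < j.+1%:R^-1] `&`
     [set omega | `|phi 0 t omega (rV_rat i.2) - x| < j.+1%:R^-1]
   else set0) omega].
pose Q omega := C1_diffeomorphism (phi 0 t omega).
have T0 : 0 \in `[0, T] by rewrite in_itv/= lexx (le_trans t0).
have mA j : measurable (A j).
  apply: measurable_bigcup_count => i; case: ifPn => // _.
  by apply: measurableI; apply: measurable_norm_lt => //;
    exact: adapted_measurable (lexx 0) (flow_adapted hphi _ T0) tT.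
have aeQ : {ae P, forall omega, Q omega}.
  by have := flow_diffeomorphism hphi; apply: filterS => omega; exact.
have [] := @bad_event_small A Q mA _ _ aeQ p p0.
- move=> j k jk omega [i Hi]; exists i; move: Hi; case: ifPn => // _ /= [h1 h2].
  have kj : k.+1%:R^-1 <= j.+1%:R^-1 :> R.
    by rewrite lef_pV2 ?posrE ?ltr0n// ler_nat.
  by split; [exact: lt_le_trans kj|exact: lt_le_trans kj].
- apply: aeW => omega [bij _ [dinv _]].
  have [fK _] := inverseK bij.
  set f := phi 0 t omega in fK dinv *.
  have cinv : {for x, continuous (u0 \o inverse f)}.
    apply: continuous_comp; last exact: cu0.
    exact: differentiable_continuous.
  have e20 : 0 < e / 2 by rewrite divr_gt0.
  have ninv : \forall z \near x, `|u0 (inverse f x) - u0 (inverse f z)| < e / 2.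
    exact: (cvgrPdist_lt _ _).1 cinv _ e20.
  have [rho /= rho0 hrho] := (nbhs_ballP _ _).1 ninv.
  exists (Num.truncn rho^-1) => -[[q q']] /=; case: ifPn => //= eu [h1 h2].
  have jrho : (Num.truncn rho^-1).+1%:R^-1 <= rho.
    by rewrite invf_ple ?posrE ?ltr0n// ltW// truncnS_gt.
  have near_x z : `|f z - x| < (Num.truncn rho^-1).+1%:R^-1 ->
      `|u0 (inverse f x) - u0 z| < e / 2.
    move=> fz; have := hrho (f z); rewrite /= fK; apply.
    by rewrite -ball_normE/= distrC (lt_le_trans fz).
  have := ler_distD (u0 (inverse f x)) (u0 (rV_rat q)) (u0 (rV_rat q')).
  have := near_x _ h1; have := near_x _ h2; rewrite (distrC _ (u0 (rV_rat q))).
  lra.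
move=> j PA; exists j.+1%:R^-1, (A j); split => //.
move: aeQ; apply: filterS => omega [_ [df _] _] nA y y' hy hy'.
set f := phi 0 t omega in df hy hy' *.
have cf : continuous f by move=> z; exact: differentiable_continuous.
rewrite leNgt; apply/negP => bad.
have near_rat z (c : R) : `|f z - x| < j.+1%:R^-1 -> e < `|u0 z - c| ->
    exists q, `|f (rV_rat q) - x| < j.+1%:R^-1 /\ e < `|u0 (rV_rat q) - c|.
  move=> fz uz; apply: (@rV_rat_nbhs _ _ z
    ([set z | `|f z - x| < j.+1%:R^-1] `&` [set z | e < `|u0 z - c|])).
  apply: filterI.
    have cn : {for z, continuous (fun z => `|f z - x|)}.
      apply: continuous_comp (@norm_continuous _ _ _).
      by apply: continuousB; [exact: cf|exact: cst_continuous].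
    exact: (cn _ (lt_nbhsl fz)).
  have cn : {for z, continuous (fun z => `|u0 z - c|)}.
    apply: continuous_comp (@norm_continuous _ _ _).
    by apply: continuousB; [exact: cu0|exact: cst_continuous].
  exact: (cn _ (lt_nbhsr uz)).
(* The conditions are open in each point, so [y] and then [y'] can be replaced by rational points;
   [distrC] exchanges their roles. *)
have [q [fq uq]] := near_rat _ _ hy bad; rewrite distrC in uq.
have [q' [fq' uq']] := near_rat _ _ hy' uq; rewrite distrC in uq'.
by apply: nA; exists (q, q'); rewrite /= uq'.
Qed.

(** In [flow_solution] the null set depends on the starting time and point. Grid times and rational
    points are countably many, so a single null set suffices for all of them. *)
Lemma flow_solves_grid M t : bounded_field T M b -> t \in `[0, T] ->
  {ae P, forall omega N k q, (0 < N)%N -> (k <= N)%N ->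
    let y := rV_rat q in let s := grid t N k in
    solves T b (W ^~ omega) s (fun v => phi s v omega y) /\
    phi s s omega y = y}.
Proof.
move=> fb tT; have [t0 tleT] : 0 <= t /\ t <= T.
  by move: tT; rewrite in_itv => /andP.
pose good (i : nat * nat * 'rV[rat]_n) omega :=
  (0 < i.1.1)%N -> (i.1.2 <= i.1.1)%N ->
  let y := rV_rat i.2 in let s := grid t i.1.1 i.1.2 in
  solves T b (W ^~ omega) s (fun v => phi s v omega y) /\
  phi s s omega y = y.
have : {ae P, forall omega i, good i omega}.
  apply: ae_forall_count => -[[N k] q]; rewrite /good/=.
  have [/andP[N0 kN]|h] := boolP ((0 < N)%N && (k <= N)%N); last first.
    by apply: aeW => omega N0 kN; rewrite N0 kN in h.
  have /andP[s0 st] := grid_itv t0 N0 kN; have sT := le_trans st tleT.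
  have s0T : grid t N k \in `[0, T] by rewrite in_itv/= s0.
  have := flow_solution hphi (rV_rat q) s0T; apply: filterS => omega sol _ _.
  by have := integral_solution_solves fb s0 sT sol.
by apply: filterS => omega h N k q; exact: (h (N, k, q)).
Qed.

End flow.

End events.

(** * Convergence of the transported solutions *)

Section holder.
Context {R : realType} {n : nat}.

Lemma holder_continuous (f : 'rV[R]_n -> 'rV[R]_n) (K alpha : R) :
  0 <= K -> 0 < alpha ->
  (forall x y, `|f x - f y| <= K * `|x - y| `^ alpha) -> continuous f.
Proof.
move=> K0 alpha0 fK x U /nbhs_ballP[e /= e0 eU].
have K1 : 0 < K + 1 by rewrite ltr_wpDl.
(* Chosen so that [(K + 1) * r ^ alpha = e / 2]; the added 1 covers [K = 0]. *)
pose r := (e / 2 / (K + 1)) `^ alpha^-1.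
have r0 : 0 < r by rewrite powR_gt0// !divr_gt0.
have ra : r `^ alpha = e / 2 / (K + 1).
  by rewrite /r -powRrM mulVf ?lt0r_neq0// powRr1// !divr_ge0// ltW.
apply/nbhs_ballP; exists r => //= y; rewrite -ball_normE/= => xy.
apply: eU; rewrite -ball_normE/=.
apply: (le_lt_trans (fK _ _)).
apply: (@le_lt_trans _ _ ((K + 1) * (e / 2 / (K + 1)))).
  rewrite -ra ler_pM ?powR_ge0//; first by rewrite lerDl.
  by rewrite ge0_ler_powR ?nnegrE// ltW.
by rewrite mulrC divfK ?lt0r_neq0// ltr_pdivrMr//; lra.
Qed.

End holder.

Theorem theorem28 (R : realType) (d : nat) (T : R)
  (disp : measure_display) (Omega : measurableType disp) (P : probability Omega R)
  (F : R -> set (set Omega)) (W : R -> Omega -> 'rV[R]_d)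
  (b : R -> 'rV[R]_d -> 'rV[R]_d) (divb : R -> 'rV[R]_d -> R)
  (u0 : 'rV[R]_d -> R)
  (phi : R -> R -> Omega -> 'rV[R]_d -> 'rV[R]_d)
  (Wn : nat -> R -> Omega -> 'rV[R]_d)
  (bn : nat -> R -> 'rV[R]_d -> 'rV[R]_d)
  (varphi : nat -> R -> Omega -> 'rV[R]_d -> 'rV[R]_d)
  (un : nat -> R -> 'rV[R]_d -> Omega -> R)
  (u : R -> 'rV[R]_d -> Omega -> R)
  (hT : 0 < T) (hd : (1 <= d)%N)
  (hF : is_filtration T F)
  (hW : brownian_motion P T F W)
  (hb : exists2 alpha, 0 < alpha < 1 & Linfty_Cb T alpha b)
  (hdiv : is_divergence T b divb)
  (hdiv1 : L1_L1loc T divb)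
  (hu0 : continuous u0)
  (hu0b : exists M, forall x, `|u0 x| <= M)
  (hphi : stochastic_flow P T F b W phi)
  (hWn : forall n t, t \in `[0, T] -> measurable_fun setT (Wn n t))
  (hWnd : forall n, {ae P, forall omega,
     derivable_oo_LRcontinuous (fun t => Wn n t omega) 0 T})
  (hWnW : cvg_in_probability_C0 P T Wn W)
  (hbn : forall n,
     measurable_fun (strip T) (fun p : R * 'rV[R]_d => bn n p.1 p.2))
  (hbnb : exists M, forall n t x, t \in `[0, T] -> `|bn n t x| <= M)
  (hbnc : {ae @lebesgue_measure R, forall t, t \in `[0, T] ->
     (forall n, C1b (bn n t)) /\
     {family compact, (fun n => bn n t) @ \oo --> b t}})
  (hvarphim : forall n t x, t \in `[0, T] ->
     measurable_fun setT (fun omega => varphi n t omega x))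
  (hvarphi : forall n, {ae P, forall omega,
     ode_flow T (bn n) (fun t => Wn n t omega) (fun t => varphi n t omega)})
  (hun : forall n, {ae P, forall omega,
     unique_transport_solution T (bn n) (fun t => Wn n t omega) u0
       (fun t x => un n t x omega)})
  (hunr : forall n, {ae P, forall omega, forall t x, t \in `[0, T] ->
     un n t x omega = u0 (inverse (varphi n t omega) x)})
  (hu : stratonovich_transport_solution P T F b divb W u0 u)
  (hur : {ae P, forall omega, forall t x, t \in `[0, T] ->
     u t x omega = u0 (inverse (phi 0 t omega) x)})
  (t : R) (x : 'rV[R]_d) (ht : t \in `[0, T]) :
  cvg_in_probability P (fun n => un n t x) (u t x).
Proof.
have [alpha /andP[alpha0 _] [mb [M1 bM1] [K1 bK1]]] := hb.
have [M2 bM2] := hbnb.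
pose M := Num.max 0 (Num.max M1 M2).
have M0 : 0 <= M by rewrite /M le_max lexx.
have fb : bounded_field T M b.
  split=> // r y rT; rewrite (le_trans (bM1 _ _ rT))//.
  by rewrite /M !le_max lexx orbT.
have fbn m : bounded_field T M (bn m).
  split; first exact: hbn.
  move=> r y rT; rewrite (le_trans (bM2 m _ y rT))//.
  by rewrite /M !le_max lexx !orbT.
pose K := Num.max 0 K1.
have K0 : 0 <= K by rewrite /K le_max lexx.
have bK r y z : r \in `[0, T] -> `|b r y - b r z| <= K * `|y - z| `^ alpha.
  move=> rT; rewrite (le_trans (bK1 _ _ _ rT))// ler_wpM2r ?powR_ge0//.
  by rewrite /K le_max lexx orbT.
have cb r : r \in `[0, T] -> continuous (b r).
  by move=> rT; apply: (holder_continuous K0 alpha0) => y z; exact: bK.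
have [t0 tT] : 0 <= t /\ t <= T by move: ht; rewrite in_itv => /andP.
have T0' : 0 \in `[0, T] by rewrite in_itv/= lexx ltW.
apply: vanishes_in_probability_dominated hWnW _ => eps p eps0 p0.
have p30 : 0 < p / 3 by rewrite divr_gt0.
have [k [B1 [mB1 PB1 hB1]]] := path_bounded_outside hF hT p30
  (bm_adapted hW) (bm_continuous hW).
(* The curve stays within [M * T + 2 * (k + eta)] of [x] with [eta <= 1]; the constant 4 also covers
   the margin 1 asked for by [flow_telescope]. *)
pose r := `|x| + M * T + 2 * k%:R + 4.
have [L [B2 [mB2 PB2 hB2]]] := flow_lipschitz_outside hF hphi r ht p30.
have eps20 : 0 < eps / 2 by rewrite divr_gt0.
have [rho [B3 [rho0 mB3 PB3 hB3]]] :=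
  inverse_flow_modulus hF hphi x hu0 ht eps20 p30.
have rho20 : 0 < rho / 2 by rewrite divr_gt0.
have [N [zeta [N0 zeta0 small stab]]] :=
  stability_parameters M0 K0 alpha0 t0 (ler0n R L) rho20.
(* The distance [zeta / 4] between the paths and [zeta / 2] from the drifts together stay below
   [zeta]. *)
pose eta := Num.min 1 (zeta / 4).
have eta0 : 0 < eta by rewrite lt_min ltr01 divr_gt0.
have eta1 : eta <= 1 by rewrite /eta ge_min lexx.
have etaz : eta <= zeta / 4 by rewrite /eta ge_min lexx orbT.
exists (B1 `|` B2 `|` B3), eta; split => //.
- by apply: measurableU => //; exact: measurableU.
- apply: (@le_trans _ _ (P (B1 `|` B2) + P B3)%E).
    by apply: measureU2 => //; exact: measurableU.
  apply: (@le_trans _ _ (P B1 + P B2 + P B3)%E).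
    by rewrite leeD2r//; exact: measureU2.
  have -> : p%:E = ((p / 3)%:E + (p / 3)%:E + (p / 3)%:E)%E.
    by rewrite -!EFinD; congr EFin; lra.
  by rewrite !leeD.
have zeta20 : 0 < zeta / 2 by rewrite divr_gt0.
have := drift_integral_small (ltW hT) M0 fb fbn cb hbnc r zeta20.
apply: filterS => m drift.
near=> omega.
have ode : ode_flow T (bn m) (fun t => Wn m t omega)
    (fun t => varphi m t omega).
  by near: omega; exact: hvarphi.
have unE : un m t x omega = u0 (inverse (varphi m t omega) x).
  have h : forall t x, t \in `[0, T] ->
      un m t x omega = u0 (inverse (varphi m t omega) x).
    by near: omega; exact: hunr.
  exact: h.
have uE : u t x omega = u0 (inverse (phi 0 t omega) x).
  have h : forall t x, t \in `[0, T] ->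
      u t x omega = u0 (inverse (phi 0 t omega) x).
    by near: omega; exact: hur.
  exact: h.
have diffeo : forall s t, 0 <= s -> s <= t -> t <= T ->
    C1_diffeomorphism (phi s t omega).
  by near: omega; exact: (flow_diffeomorphism hphi).
have cocycle : forall s r t, 0 <= s -> s <= r -> r <= t -> t <= T ->
    phi s t omega = phi r t omega \o phi s r omega.
  by near: omega; exact: (flow_cocycle hphi).
have phi_id : forall s, s \in `[0, T] -> phi s s omega = id.
  by near: omega; exact: (flow_id hphi).
have Wk : ~ B1 omega -> forall s, s \in `[0, T] -> `|W s omega| <= k%:R.
  by near: omega; exact: hB1.
have lip : ~ B2 omega -> forall N k x y, (0 < N)%N -> (k <= N)%N ->
    `|x| < r -> `|y| < r ->
    `|phi (grid t N k) t omega x - phi (grid t N k) t omega y| <=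
      L%:R * `|x - y|.
  by near: omega; exact: hB2.
have modulus : ~ B3 omega -> forall y y',
    `|phi 0 t omega y - x| < rho -> `|phi 0 t omega y' - x| < rho ->
    `|u0 y - u0 y'| <= eps / 2.
  by near: omega; exact: hB3.
have sol : forall N k q, (0 < N)%N -> (k <= N)%N ->
    let y := rV_rat q in let s := grid t N k in
    solves T b (W ^~ omega) s (fun v => phi s v omega y) /\
    phi s s omega y = y.
  by near: omega; exact: (flow_solves_grid hphi fb ht).
move=> nB supW.
have /Wk{}Wk : ~ B1 omega by move=> B1o; apply: nB; left; left.
have /lip{}lip : ~ B2 omega by move=> B2o; apply: nB; left; right.
have /modulus{}modulus : ~ B3 omega by move=> B3o; apply: nB; right.
have Weta s : s \in `[0, T] -> `|Wn m s omega - W s omega| <= eta.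
  move=> sT; rewrite -lee_fin; apply: le_trans (ltW supW).
  by apply: ereal_sup_ubound; exists s.
pose y := inverse (varphi m t omega) x.
pose X s := varphi m s omega y.
have Xt : X t = x.
  have [bij _ _] := ode_flow_homeomorphism ode ht.
  exact: (inverseK bij).2.
have [solX X0] : solves T (bn m) (fun t => Wn m t omega) 0 X /\ X 0 = y.
  apply: integral_solution_solves (fbn m) _ _ _ => //; first exact: ltW.
  exact: ode_flow_solution ode y.
have Xr s : s \in `[0, T] -> `|X s| + 1 < r.
  move=> sT; have [s0 sT'] : 0 <= s /\ s <= T.
    by move: sT; rewrite in_itv => /andP.
  have WnB v : v \in `[0, T] -> `|Wn m v omega| <= k%:R + eta.
    move=> vT; have := Weta v vT; have := Wk v vT.
    have := ler_normB (W v omega) (W v omega - Wn m v omega).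
    by rewrite subKr (distrC (W v omega)); lra.
  have incr v v' : 0 <= v -> v <= v' -> v' <= T ->
      `|X v' - X v| <= M * T + 2 * (k%:R + eta).
    move=> v0 vv' v'T; rewrite (solX.2 v v')//.
    have [mbX bX] := field_along (fbn m) v0 v'T (solves_sub solX v0 v'T).
    have h1 := rV_integral_le vv' M0 mbX bX.
    have h2 : M * (v' - v) <= M * T by rewrite ler_wpM2l//; lra.
    have vT : v \in `[0, T] by rewrite in_itv/= v0 (le_trans vv').
    have v'T' : v' \in `[0, T] by rewrite in_itv/= v'T (le_trans v0).
    have := WnB _ vT; have := WnB _ v'T'.
    have := ler_normB (Wn m v' omega) (Wn m v omega).
    have := ler_normD (rV_integral v v' (fun w => bn m w (X w)))
      (Wn m v' omega - Wn m v omega).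
    lra.
  (* The increments are measured from time [t], forwards or backwards, because the end point [x] is
     deterministic whereas the start [y] is random. *)
  have : `|X s - x| <= M * T + 2 * (k%:R + eta).
    rewrite -Xt; have [st|/ltW st] := leP s t; last exact: incr.
    by rewrite distrC; exact: incr.
  have := ler_normD x (X s - x); rewrite addrC subrK /r; lra.
pose Z s := Wn m s omega - W s omega +
  rV_integral 0 s (fun v => bn m v (X v) - b v (X v)).
have solXZ : solves T b (fun v => W v omega + Z v) 0 X.
  exact: solves_perturb fb (fbn m) solX.
have Zz s : s \in `[0, T] -> `|Z s| <= zeta.
  move=> sT; rewrite (le_trans (ler_normD _ _))//.
  have Xr' v : v \in `[0, T] -> `|X v| < r by move=> /Xr; lra.
  by have := drift X solX.1 Xr' s sT; have := Weta s sT; lra.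
have grid_in j : (j <= N)%N -> grid t N j \in `[0, T].
  move=> jN; have /andP[g0 gt'] := grid_itv t0 N0 jN.
  by rewrite in_itv/= g0 (le_trans gt').
have close : `|phi 0 t omega y - x| < rho.
  rewrite -Xt -X0.
  apply: (@le_lt_trans _ _ (rho / 2)); last by rewrite ltr_pdivrMr//; lra.
  apply: le_trans stab.
  apply: (@flow_telescope _ _ T M M0 K alpha b K0 alpha0 fb bK
    (fun s v => phi s v omega) (W ^~ omega) X Z t N zeta r L%:R) => //.
  - by move=> j q jN; exact: sol.
  - by move=> j z z' jN; exact: lip.
  - move=> j z jN; have /andP[g0 _] := grid_itv t0 N0 (ltnW jN).
    have /andP[_ g1] := grid_itv t0 N0 jN.
    rewrite (cocycle (grid t N j) (grid t N j.+1) t)//.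
    by rewrite /grid ler_wpM2r ?invr_ge0// ler_wpM2l// ler_nat.
  - by move=> z; rewrite phi_id.
  - by move=> j jN; apply: Xr; exact: grid_in.
have [bij _ _] := diffeo 0 t (lexx 0) t0 tT.
(* The second point handed to [modulus] is sent by [phi 0 t] exactly to [x], so only [close] is
   needed for the first. *)
rewrite unE uE lte_fin; apply: (@le_lt_trans _ _ (eps / 2)).
  apply: modulus => //; rewrite (inverseK bij).2 subrr normr0//.
by rewrite ltr_pdivrMr//; lra.
Unshelve. all: by end_near. Qed.
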